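(* Let $h:[0,\infty)\to[0,\infty)$ be upper semicontinuous and suppose there exists $R>0$ such that $\operatorname{supp}h\subset[0,R]$. Let $u$ be the maximal viscosity solution of $$u_t-\left(\operatorname{div}\left(\frac{Du}{|Du|}\right)+1\right)|Du|=h(|x|)\ \text{ in }\mathbb{R}^n\times(0,\infty),\qquad u(\cdot,0)=0\ \text{ on }\mathbb{R}^n .$$ Set $$c_1:=\max_{r\in[n-1,\infty)}h(r),\qquad c_2:=\sup_{r\in(n-1,\infty)}h(r).$$ Then $$\lim_{t\to\infty}\frac{u(x,t)}{t}=c_1\quad\text{uniformly for }x\in\overline{B}(0,n-1),$$ $$\lim_{t\to\infty}\frac{u(x,t)}{t}=c_2\quad\text{locally uniformly for }x\in\mathbb{R}^n\setminus\overline{B}(0,n-1).$$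
   Context: $n$ is the dimension of the space $\mathbb{R}^n$. $B(x,R)$ is the open ball of radius $R$ centered at $x$, $\overline{B}(x,R)$ its closure. Viscosity solutions. Let $\mathbb{S}^n$ be the real symmetric $n\times n$ matrices. For $p\in\mathbb{R}^n\setminus\{0\}$, $X\in\mathbb{S}^n$ put $\sigma(p)=I-(p\otimes p)/|p|^2$ and $H(p,X)=-\operatorname{tr}[\sigma(p)X]-|p|$; $H_*$, $H^*$ denote the lower and upper semicontinuous envelopes of $H$ on $\mathbb{R}^n\times\mathbb{S}^n$. In general $g^*$, $g_*$ denote the upper and lower semicontinuous envelopes of a locally bounded function $g$. For a bounded right-hand side $f:\mathbb{R}^n\to[0,\infty)$ and continuous initial datum $u_0$, a locally bounded $u:\mathbb{R}^n\times[0,\infty)\to\mathbb{R}$ is a viscosity subsolution of $u_t-(\operatorname{div}(Du/|Du|)+1)|Du|=f(x)$, $u(\cdot,0)=u_0$, if $u^*(\cdot,0)\le u_0$ and $\tau+H_*(p,X)\le f^*(x_0)$ for all $(x_0,t_0)\in\mathbb{R}^n\times(0,\infty)$ and $(p,X,\tau)\in J^+u^*(x_0,t_0)$; it is a viscosity supersolution if $u_*(\cdot,0)\ge u_0$ and $\tau+H^*(p,X)\ge f_*(x_0)$ for all $(x_0,t_0)\in\mathbb{R}^n\times(0,\infty)$ and $(p,X,\tau)\in J^-u_*(x_0,t_0)$; it is a viscosity solution if it is both. Here $J^\pm$ are the parabolic super/sub semijets: $(p,X,\tau)\in J^+v(x_0,t_0)$ iff $v(x,t)\le v(x_0,t_0)+\tau(t-t_0)+p\cdot(x-x_0)+\frac12X(x-x_0)\cdot(x-x_0)+o(|t-t_0|+|x-x_0|^2)$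 as $(x,t)\to(x_0,t_0)$, and $J^-v=-J^+(-v)$. A function $u$ is called compactly supported in space if for every $T>0$ there is $R_T>0$ with $u(x,t)=0$ for $x\notin B(0,R_T)$, $t\in[0,T]$. The maximal viscosity solution is the viscosity solution $u$, compactly supported in space, such that $u\ge v$ on $\mathbb{R}^n\times[0,\infty)$ for every viscosity solution $v$ compactly supported in space.
   Formalization: The dimension is assumed to satisfy n ≥ 2; for n = 1 the claim fails: with h the indicator of {0}, the maximal solution is (t−|x|)^+, so u(x,t)/t → 1 for every x although c_2 = 0. *)

(* Defs.v *)
From HB Require Import structures.
From mathcomp Require Import all_boot all_order all_algebra.
From mathcomp Require Import all_classical all_reals all_analysis.

Set Implicit Arguments.
Unset Strict Implicit.
Unset Printing Implicit Defensive.

Import Order.TTheory GRing.Theory Num.Theory.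
Import numFieldNormedType.Exports.

Local Open Scope classical_set_scope.
Local Open Scope ring_scope.

(* The library norm `|x| on 'rV_n is the sup norm; it induces the usual
   topology, but balls and |p| must be measured with the Euclidean norm. *)
Definition dotv (R : realType) (n : nat) (x y : 'rV[R]_n) : R :=
  \sum_(i < n) x 0 i * y 0 i.

Definition enorm (R : realType) (n : nat) (x : 'rV[R]_n) : R :=
  Num.sqrt (dotv x x).

(* Vectors are rows, so X y . y is (y *m X) . y. *)
Definition quadv (R : realType) (n : nat) (X : 'M[R]_n) (y : 'rV[R]_n) : R :=
  dotv (y *m X) y.

(* Semicontinuous envelopes at z of a function defined on D only. The
   neighbourhoods are not punctured. [fine] is harmless when g is locally
   bounded on D and z lies in the closure of D. *)
Definition upper_env (R : realType) (T : topologicalType) (D : set T)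
    (g : T -> R) (z : T) : R :=
  fine (limf_esup (fun w => (g w)%:E) (within D (nbhs z))).

Definition lower_env (R : realType) (T : topologicalType) (D : set T)
    (g : T -> R) (z : T) : R :=
  fine (limf_einf (fun w => (g w)%:E) (within D (nbhs z))).

Definition locally_bounded_on (R : realType) (T : topologicalType) (D : set T)
    (g : T -> R) : Prop :=
  forall z, D z -> bounded_near g (within D (nbhs z)).

Definition upper_semicontinuous_on (R : realType) (T : topologicalType)
    (D : set T) (g : T -> R) : Prop :=
  forall z, D z -> forall a, g z < a ->
    \forall w \near within D (nbhs z), g w < a.

Definition sigma_mx (R : realType) (n : nat) (p : 'rV[R]_n) : 'M[R]_n :=
  1%:M - (enorm p ^+ 2)^-1 *: (p^T *m p).

Definition Hop (R : realType) (n : nat) (z : 'rV[R]_n * 'M[R]_n) : R :=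
  - \tr (sigma_mx z.1 *m z.2) - enorm z.1.

Definition Hdom (R : realType) (n : nat) : set ('rV[R]_n * 'M[R]_n) :=
  [set z | z.1 != 0 /\ z.2^T = z.2].

Definition H_upper (R : realType) (n : nat) (p : 'rV[R]_n) (X : 'M[R]_n) : R :=
  upper_env (@Hdom R n) (@Hop R n) (p, X).

Definition H_lower (R : realType) (n : nat) (p : 'rV[R]_n) (X : 'M[R]_n) : R :=
  lower_env (@Hdom R n) (@Hop R n) (p, X).

(* Functions on R^n x [0, oo) are represented by total functions on R^n x R
   whose values at negative times are never used. *)
Definition spacetime (R : realType) (n : nat) : set ('rV[R]_n * R) :=
  [set z | 0 <= z.2].

Definition superjet (R : realType) (n : nat) (v : 'rV[R]_n * R -> R)
    (x0 : 'rV[R]_n) (t0 : R) (p : 'rV[R]_n) (X : 'M[R]_n) (tau : R) : Prop :=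
  X^T = X /\
  forall e : R, 0 < e ->
    \forall z \near (x0, t0),
      v z <= v (x0, t0) + tau * (z.2 - t0) + dotv p (z.1 - x0)
             + 2^-1 * quadv X (z.1 - x0)
             + e * (`|z.2 - t0| + enorm (z.1 - x0) ^+ 2).

Definition subjet (R : realType) (n : nat) (v : 'rV[R]_n * R -> R)
    (x0 : 'rV[R]_n) (t0 : R) (p : 'rV[R]_n) (X : 'M[R]_n) (tau : R) : Prop :=
  superjet (fun z => - v z) x0 t0 (- p) (- X) (- tau).

Definition viscosity_subsolution (R : realType) (n : nat)
    (f u0 : 'rV[R]_n -> R) (u : 'rV[R]_n * R -> R) : Prop :=
  [/\ locally_bounded_on (@spacetime R n) u,
      (forall x, upper_env (@spacetime R n) u (x, 0) <= u0 x)
    & forall x0 t0 p X tau, 0 < t0 ->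
        superjet (upper_env (@spacetime R n) u) x0 t0 p X tau ->
        tau + H_lower p X <= upper_env setT f x0].

Definition viscosity_supersolution (R : realType) (n : nat)
    (f u0 : 'rV[R]_n -> R) (u : 'rV[R]_n * R -> R) : Prop :=
  [/\ locally_bounded_on (@spacetime R n) u,
      (forall x, u0 x <= lower_env (@spacetime R n) u (x, 0))
    & forall x0 t0 p X tau, 0 < t0 ->
        subjet (lower_env (@spacetime R n) u) x0 t0 p X tau ->
        lower_env setT f x0 <= tau + H_upper p X].

Definition viscosity_solution (R : realType) (n : nat)
    (f u0 : 'rV[R]_n -> R) (u : 'rV[R]_n * R -> R) : Prop :=
  viscosity_subsolution f u0 u /\ viscosity_supersolution f u0 u.

Definition compactly_supported_in_space (R : realType) (n : nat)
    (u : 'rV[R]_n * R -> R) : Prop :=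
  forall T : R, 0 < T -> exists2 RT : R, 0 < RT &
    forall x t, ~ enorm x < RT -> 0 <= t <= T -> u (x, t) = 0.

Definition maximal_viscosity_solution (R : realType) (n : nat)
    (f u0 : 'rV[R]_n -> R) (u : 'rV[R]_n * R -> R) : Prop :=
  [/\ viscosity_solution f u0 u, compactly_supported_in_space u
    & forall v, viscosity_solution f u0 v -> compactly_supported_in_space v ->
        forall x t, 0 <= t -> v (x, t) <= u (x, t)].

Definition closed_eball (R : realType) (n : nat) (x : 'rV[R]_n) (r : R) :
    set 'rV[R]_n :=
  [set y | enorm (y - x) <= r].

Definition locally_uniformly (R : realType) (n : nat) (O : set 'rV[R]_n)
    (g : R -> 'rV[R]_n -> R) (l : 'rV[R]_n -> R) : Prop :=
  forall K : set 'rV[R]_n, compact K -> K `<=` O ->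
    {uniform K, g t @[t --> +oo] --> l}.

(* Main.v *)
Require Import Defs.
From HB Require Import structures.
From mathcomp Require Import all_boot all_order all_algebra.
From mathcomp Require Import all_classical all_reals all_analysis.
From mathcomp Require Import ring lra.

Set Implicit Arguments.
Unset Strict Implicit.
Unset Printing Implicit Defensive.

Import Order.TTheory GRing.Theory Num.Theory.
Import numFieldNormedType.Exports.

Local Open Scope classical_set_scope.
Local Open Scope ring_scope.

(** For a radial function [u (x, t) = w (r, t)], [r = |x|], the equation becomes
    [w_t - ((n - 1) / r) w_r - |w_r| = h r]. This is the Hamilton-Jacobi equation
    of a control problem: maximise the integral of [h] along paths with
    [r' = (n - 1) / r + a] and [-1 <= a <= 1]. A radius [r >= n - 1] can be held by
    choosing [a = - (n - 1) / r]. Paths starting outside the critical sphere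
    [r = n - 1] can reach every supercritical radius but not the critical sphere
    itself, so their best rate is [c2]. Paths starting in the closed critical ball
    are driven outwards and may also stop on the critical sphere, so their best
    rate is [c1].

    Lower bounds. Since [h] is only upper semicontinuous, the lower envelope of the
    source may vanish, and being a supersolution gives nothing; maximality must be
    used. The value function of the control problem is itself a compactly supported
    viscosity solution ([value_viscosity], [value_compact_support]), hence lies
    below [u], and explicit paths bound it from below ([value_lower_inside],
    [value_lower_outside]). It is a viscosity solution because its envelopes satisfy
    dynamic programming principles ([upper_value_dpp], [lower_value_dpp]) that
    involve the norm of the space variable only. A jet can therefore be tested at
    points displaced tangentially by the square root of the elapsed time, which
    brings in the curvature term ([superjet_radial], [subjet_radial]).

    Upper bounds. A compactly supported subsolution lies below explicit strict
    supersolutions [k t + g (|x|^2)] with [g] nonincreasing ([comparison]). Inside the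
    critical ball a steep [g] compensates any source, which gives the rate [c1]
    everywhere ([growth_upper]). Outside, [g] is a small multiple of minus the
    logarithm of the distance to the critical sphere: it is infinite there, which
    shields the exterior from larger values of [h], and it is slowly varying enough
    to keep the rate close to [c2] ([growth_upper_outside]). *)

(** * Semicontinuous envelopes *)

Section Envelopes.
Variables (R : realType) (T : topologicalType).
Implicit Types (D : set T) (g : T -> R) (z : T).

(** Local boundedness keeps the limit superior finite, so that [fine] in the
    envelopes never replaces an infinite value by zero. *)
Lemma limf_esup_fin g (F : set_system T) : ProperFilter F ->
  bounded_near g F ->
  limf_esup (fun w => (g w)%:E) F \is a fin_num.
Proof.
move=> FF [M [_ HM]]; have FM : F [set w | `|g w| <= M + 1] by apply: HM; rewrite ltrDl.
rewrite limf_esupE fin_real//; apply/andP; split.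
- apply: (@lt_le_trans _ _ (- (M + 1))%:E); first exact: ltNyr.
  apply: le_ereal_inf_tmp => _ [V FV <-].
  have [w [Vw /= gw]] := filter_ex (filterI FV FM).
  apply: le_ereal_sup_tmp; exists (g w)%:E; first by exists w.
  by rewrite lee_fin; move: gw; rewrite ler_norml => /andP[].
- apply: (@le_lt_trans _ _ (M + 1)%:E); last exact: ltry.
  apply: ge_ereal_inf; exists (ereal_sup ((fun w => (g w)%:E) @` [set w | `|g w| <= M + 1])).
    by exists [set w | `|g w| <= M + 1].
  apply: ge_ereal_sup => _ [w /= gw <-].
  by rewrite lee_fin; move: gw; rewrite ler_norml => /andP[].
Qed.

Lemma upper_env_le D g z a : ProperFilter (within D (nbhs z)) ->
  bounded_near g (within D (nbhs z)) ->
  (\forall w \near within D (nbhs z), g w <= a) -> upper_env D g z <= a.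
Proof.
move=> FF bg ga; rewrite /upper_env -lee_fin fineK ?limf_esup_fin//.
rewrite limf_esupE; apply: ge_ereal_inf.
exists (ereal_sup ((fun w => (g w)%:E) @` [set w | g w <= a])).
  by exists [set w | g w <= a].
by apply: ge_ereal_sup => _ [w /= gw <-]; rewrite lee_fin.
Qed.

Lemma upper_env_lt D g z a : ProperFilter (within D (nbhs z)) ->
  bounded_near g (within D (nbhs z)) ->
  upper_env D g z < a -> \forall w \near within D (nbhs z), g w < a.
Proof.
move=> FF bg; rewrite /upper_env -lte_fin fineK ?limf_esup_fin//.
rewrite limf_esupE => /ereal_inf_lt[_ [V FV <-] Va].
apply: filterS FV => w Vw; rewrite -lte_fin; apply: le_lt_trans Va.
by apply: ereal_sup_ubound; exists w.
Qed.

Lemma upper_env_freq D g z a (A : set T) : ProperFilter (within D (nbhs z)) ->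
  bounded_near g (within D (nbhs z)) ->
  a < upper_env D g z -> nbhs z A -> exists w, [/\ D w, A w & a < g w].
Proof.
move=> FF bg az zA; apply: contrapT => nex; move: az; apply/negP; rewrite -leNgt.
apply: upper_env_le => //; rewrite /within/=.
apply: filterS zA => w Aw Dw.
by rewrite leNgt; apply/negP => gw; apply: nex; exists w.
Qed.

Lemma lower_envE D g z : lower_env D g z = - upper_env D (fun w => - g w) z.
Proof.
by rewrite /lower_env /upper_env /limf_einf fineN.
Qed.

Lemma bounded_nearN g (F : set_system T) : Filter F ->
  bounded_near g F -> bounded_near (fun w => - g w) F.
Proof.
move=> FF [M [rM gM]]; exists M; split=> // N /gM.
by apply: filterS => w /=; rewrite normrN.
Qed.

Lemma lower_env_ge D g z a : ProperFilter (within D (nbhs z)) ->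
  bounded_near g (within D (nbhs z)) ->
  (\forall w \near within D (nbhs z), a <= g w) -> a <= lower_env D g z.
Proof.
move=> FF bg ga; rewrite lower_envE lerNr; apply: upper_env_le.
  by apply: bounded_nearN bg.
by apply: filterS ga => w; rewrite lerN2.
Qed.

Lemma lower_env_gt D g z a : ProperFilter (within D (nbhs z)) ->
  bounded_near g (within D (nbhs z)) ->
  a < lower_env D g z -> \forall w \near within D (nbhs z), a < g w.
Proof.
move=> FF bg; rewrite lower_envE ltrNr => /upper_env_lt.
move=> /(_ (bounded_nearN _ bg)).
by apply: filterS => w; rewrite ltrN2.
Qed.

Lemma within_proper D z : D z -> ProperFilter (within D (nbhs z)).
Proof. move=> Dz; apply: within_nbhs_proper; exact: subset_closure. Qed.

Lemma upper_env_ge D g z : D z -> bounded_near g (within D (nbhs z)) ->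
  g z <= upper_env D g z.
Proof.
move=> Dz bg; have FF := within_proper Dz.
apply/ler_addgt0Pr => e e0.
have : upper_env D g z < upper_env D g z + e by rewrite ltrDl.
by move=> /(upper_env_lt FF bg)/nbhs_singleton/(_ Dz)/ltW.
Qed.

Lemma bounded_near_le g (F : set_system T) M : Filter F ->
  (\forall w \near F, `|g w| <= M) -> bounded_near g F.
Proof.
move=> FF FM; exists M; split; first exact: num_real.
move=> N /ltW MN; apply: filterS FM => w gM; exact: le_trans MN.
Qed.

(** The sets where [g] is at least one of its own values generate a proper filter
    on [K]. A cluster point of it cannot lie strictly below any value, since [g]
    would then be below that value in a whole neighbourhood. *)
Lemma usc_compact_max (K : set T) g : compact K -> K !=set0 ->
  (forall z, K z -> forall a, g z < a -> \forall w \near within K (nbhs z), g w < a) ->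
  exists2 z, K z & forall w, K w -> g w <= g z.
Proof.
move=> cK [k0 Kk0] usc; apply: contrapT => nmax.
have big z : K z -> exists2 w, K w & g z < g w.
  move=> Kz; apply: contrapT => nw; apply: nmax; exists z => // w Kw.
  by rewrite leNgt; apply/negP => zw; apply: nw; exists w.
pose G : set_system T :=
  fun A => exists2 w0, K w0 & forall w, K w -> g w0 <= g w -> A w.
have FG : ProperFilter G.
  split; first by move=> [w0 Kw0 /(_ w0 Kw0 (lexx _))].
  split.
  - by exists k0.
  - move=> A B [a Ka Aa] [b Kb Bb].
    have [ab|/ltW ba] := leP (g a) (g b).
      by exists b => // w Kw bw; split; [apply: Aa => //; exact: le_trans bw|exact: Bb].
    by exists a => // w Kw aw; split; [exact: Aa|apply: Bb => //; exact: le_trans aw].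
  - by move=> A B AB [a Ka Aa]; exists a => // w Kw aw; apply: AB; exact: Aa.
have [z [Kz clz]] : K `&` cluster G !=set0 by apply: cK; exists k0.
have [w Kw zw] := big z Kz.
have [v [[Kv wv] /(_ Kv)]] := clz [set v | K v /\ g w <= g v]
  (fun v => K v -> g v < g w) (ex_intro2 _ _ w Kw (fun v Kv wv => conj Kv wv)) (usc z Kz _ zw).
by rewrite ltNge wv.
Qed.

End Envelopes.

(** * Euclidean geometry and quadratic forms *)

Section Euclidean.
Variables (R : realType) (n : nat).
Implicit Types (x y z p q e : 'rV[R]_n) (X Y : 'M[R]_n) (a b c : R).

Lemma dotv_mx x y : dotv x y = (x *m y^T) 0 0.
Proof. by rewrite mxE; apply: eq_bigr => i _; rewrite mxE. Qed.

Lemma dotvC x y : dotv x y = dotv y x.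
Proof. by apply: eq_bigr => i _; rewrite mulrC. Qed.

Lemma dotvDl x y z : dotv (x + y) z = dotv x z + dotv y z.
Proof. by rewrite !dotv_mx mulmxDl mxE. Qed.

Lemma dotvZl a x y : dotv (a *: x) y = a * dotv x y.
Proof. by rewrite !dotv_mx -scalemxAl mxE. Qed.

Lemma dotvDr x y z : dotv z (x + y) = dotv z x + dotv z y.
Proof. by rewrite dotvC dotvDl !(dotvC z). Qed.

Lemma dotvZr a x y : dotv x (a *: y) = a * dotv x y.
Proof. by rewrite dotvC dotvZl dotvC. Qed.

Lemma dotvNl x y : dotv (- x) y = - dotv x y.
Proof. by rewrite -scaleN1r dotvZl mulN1r. Qed.

Lemma dotvNr x y : dotv x (- y) = - dotv x y.
Proof. by rewrite -scaleN1r dotvZr mulN1r. Qed.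

Lemma dotv0l y : dotv 0 y = 0.
Proof. by rewrite -(scale0r 0) dotvZl mul0r. Qed.

Lemma dotv0r y : dotv y 0 = 0.
Proof. by rewrite dotvC dotv0l. Qed.

Definition dotvE := (dotvDl, dotvDr, dotvNl, dotvNr, dotvZl, dotvZr, dotv0l, dotv0r).

Lemma dotvv_ge0 x : 0 <= dotv x x.
Proof. by apply: sumr_ge0 => i _; rewrite -expr2 sqr_ge0. Qed.

Lemma dotvv_eq0 x : (dotv x x == 0) = (x == 0).
Proof.
apply/eqP/eqP => [|->]; last by rewrite dotv0l.
move=> /eqP; rewrite psumr_eq0; last by move=> i _; rewrite -expr2 sqr_ge0.
move=> /allP x0; apply/rowP => i; rewrite !mxE.
have := x0 i (mem_index_enum _).
by rewrite mulf_eq0 orbb => /eqP.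
Qed.

Lemma enorm_ge0 x : 0 <= enorm x. Proof. exact: sqrtr_ge0. Qed.

Lemma enorm_sqr x : enorm x ^+ 2 = dotv x x.
Proof. by rewrite sqr_sqrtr// dotvv_ge0. Qed.

Lemma enorm_eq0 x : (enorm x == 0) = (x == 0).
Proof. by rewrite -dotvv_eq0 -enorm_sqr sqrf_eq0. Qed.

Lemma enorm_gt0 x : (0 < enorm x) = (x != 0).
Proof. by rewrite lt_neqAle enorm_ge0 andbT eq_sym enorm_eq0. Qed.

Lemma dotvv_gt0 x : (0 < dotv x x) = (x != 0).
Proof. by rewrite lt_neqAle dotvv_ge0 andbT eq_sym dotvv_eq0. Qed.

Lemma enorm0 : enorm (0 : 'rV[R]_n) = 0.
Proof. by apply/eqP; rewrite enorm_eq0. Qed.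

Lemma enormZ a x : enorm (a *: x) = `|a| * enorm x.
Proof. by rewrite /enorm dotvZl dotvZr mulrA -expr2 sqrtrM ?sqr_ge0// sqrtr_sqr. Qed.

Lemma enormN x : enorm (- x) = enorm x.
Proof. by rewrite -scaleN1r enormZ normrN1 mul1r. Qed.

Lemma cauchy_schwarz_sqr x y : dotv x y ^+ 2 <= dotv x x * dotv y y.
Proof.
have [->|y0] := eqVneq y 0; first by rewrite !dotv0r expr0n mulr0.
have yy : 0 < dotv y y by rewrite dotvv_gt0.
have := dotvv_ge0 (dotv y y *: x - dotv x y *: y).
rewrite !dotvE (dotvC y x) => H.
rewrite -subr_ge0 -(pmulr_rge0 _ yy); move: H; congr (0 <= _); ring.
Qed.

Lemma cauchy_schwarz x y : `|dotv x y| <= enorm x * enorm y.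
Proof.
rewrite -(@ler_pXn2r _ 2)// ?nnegrE ?mulr_ge0 ?enorm_ge0//.
by rewrite real_normK ?num_real// exprMn !enorm_sqr cauchy_schwarz_sqr.
Qed.

Lemma enormD x y : enorm (x + y) <= enorm x + enorm y.
Proof.
rewrite -(@ler_pXn2r _ 2)// ?nnegrE ?addr_ge0 ?enorm_ge0//.
rewrite sqrrD !enorm_sqr !dotvE (dotvC y x).
have := ler_norm (dotv x y); have := cauchy_schwarz x y; lra.
Qed.

Lemma coord_le_enorm x i : `|x 0 i| <= enorm x.
Proof.
rewrite -(@ler_pXn2r _ 2)// ?nnegrE ?enorm_ge0//.
rewrite real_normK ?num_real// enorm_sqr /dotv (bigD1 i)//= -expr2 lerDl.
by apply: sumr_ge0 => j _; rewrite -expr2 sqr_ge0.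
Qed.

Lemma enorm_le_coord x (d : R) : 0 <= d -> (forall i, `|x 0 i| <= d) -> enorm x <= n%:R * d.
Proof.
move=> d0 xd; rewrite -(@ler_pXn2r _ 2)// ?nnegrE ?enorm_ge0 ?mulr_ge0//.
rewrite enorm_sqr; apply: (@le_trans _ _ (\sum_(i < n) d ^+ 2)).
  apply: ler_sum => i _; rewrite -expr2 -(@real_normK _ (x 0 i)) ?num_real//.
  by rewrite ler_pXn2r ?nnegrE.
rewrite sumr_const card_ord exprMn.
have nn : (n%:R : R) <= n%:R ^+ 2 by rewrite -natrX ler_nat expnS expn1; case: n => // m; rewrite leq_pmulr.
by apply: le_trans (ler_wpM2r (sqr_ge0 d) nn); rewrite mulr_natl.
Qed.

Lemma quadv_mx X y : quadv X y = (y *m X *m y^T) 0 0.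
Proof. by rewrite /quadv dotv_mx. Qed.

Lemma quadvE X y : quadv X y = \sum_i \sum_j y 0 i * X i j * y 0 j.
Proof.
rewrite /quadv /dotv exchange_big/=; apply: eq_bigr => j _.
by rewrite mxE mulr_suml.
Qed.

Lemma quadvZ X a y : quadv X (a *: y) = a ^+ 2 * quadv X y.
Proof. by rewrite /quadv -scalemxAl !dotvE mulrA. Qed.

Lemma quadvD X Y y : quadv (X + Y) y = quadv X y + quadv Y y.
Proof. by rewrite /quadv mulmxDr !dotvE. Qed.

Lemma quadvN X y : quadv (- X) y = - quadv X y.
Proof. by rewrite /quadv mulmxN !dotvE. Qed.

Lemma quadvZX a X y : quadv (a *: X) y = a * quadv X y.
Proof. by rewrite /quadv -scalemxAr !dotvE. Qed.

Lemma quadv1 y : quadv 1%:M y = dotv y y.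
Proof. by rewrite /quadv mulmx1. Qed.

Lemma quadv_tens x y : quadv (x^T *m x) y = dotv x y ^+ 2.
Proof.
rewrite quadv_mx mulmxA -mulmxA mxE big_ord1 -!dotv_mx.
by rewrite (dotvC y) expr2.
Qed.

Lemma mxtrace_tens x X : \tr (x^T *m x *m X) = quadv X x.
Proof.
by rewrite -mulmxA mxtrace_mulC quadv_mx /mxtrace big_ord1.
Qed.

Lemma trace_sigma q X :
  \tr (sigma_mx q *m X) = \tr X - (dotv q q)^-1 * quadv X q.
Proof.
rewrite /sigma_mx mulmxBl mul1mx -scalemxAl linearB linearZ/=.
by rewrite enorm_sqr mxtrace_tens.
Qed.

Lemma sigma_sym q : (sigma_mx q)^T = sigma_mx q.
Proof. by rewrite /sigma_mx linearB/= linearZ/= trmx1 trmx_mul trmxK. Qed.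

Lemma sigma_kill q : q != 0 -> q *m sigma_mx q = 0.
Proof.
move=> q0; rewrite /sigma_mx mulmxBr mulmx1 -scalemxAr mulmxA.
have -> : q *m q^T = (dotv q q)%:M.
  by apply/matrixP => i j; rewrite !ord1 -dotv_mx mxE eqxx mulr1n.
by rewrite mul_scalar_mx scalerA enorm_sqr mulVf ?dotvv_eq0// scale1r subrr.
Qed.

Lemma sigma_idem q : q != 0 -> sigma_mx q *m sigma_mx q = sigma_mx q.
Proof.
move=> q0; rewrite {1}/sigma_mx mulmxBl mul1mx -scalemxAl -mulmxA.
by rewrite sigma_kill// mulmx0 scaler0 subr0.
Qed.

Lemma trace_sigma1 q : q != 0 -> \tr (sigma_mx q) = n%:R - 1.
Proof.
move=> q0; rewrite -[sigma_mx q]mulmx1 trace_sigma mxtrace1 quadv1.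
by rewrite mulVf ?dotvv_eq0.
Qed.

Lemma row_sigma_orth q i : q != 0 -> dotv (row i (sigma_mx q)) q = 0.
Proof.
move=> q0; have /matrixP/(_ 0 i) := sigma_kill q0; rewrite !mxE => <-.
rewrite /dotv; apply: eq_bigr => j _; rewrite mxE mulrC.
by rewrite -{1}sigma_sym mxE.
Qed.

Lemma quadv_row (M X : 'M[R]_n) i : quadv X (row i M) = (M *m X *m M^T) i i.
Proof.
by rewrite quadv_mx -row_mul tr_row mxE [RHS]mxE; apply: eq_bigr => j _; rewrite !mxE.
Qed.

Lemma sum_quadv_row_sigma q X : q != 0 ->
  \sum_i quadv X (row i (sigma_mx q)) = \tr (sigma_mx q *m X).
Proof.
move=> q0; under eq_bigr do rewrite quadv_row sigma_sym.
by rewrite -/(mxtrace _) mxtrace_mulC mulmxA sigma_idem.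
Qed.

Lemma sum_dotv_row_sigma q : q != 0 ->
  \sum_i dotv (row i (sigma_mx q)) (row i (sigma_mx q)) = n%:R - 1.
Proof.
move=> q0; rewrite -(trace_sigma1 q0) -[sigma_mx q in RHS]mulmx1.
by rewrite -sum_quadv_row_sigma//; apply: eq_bigr => i _; rewrite quadv1.
Qed.

(** The curvature term is, up to the factor [n - 1], an average of [X] over the
    directions orthogonal to [q]: the rows of the projection [sigma_mx q] take the place of an orthonormal
    basis of the orthogonal complement of [q]. *)
Lemma trace_sigma_le q X K : q != 0 -> (1 < n)%N ->
  (forall e, dotv e q = 0 -> (n%:R - 1) * quadv X e <= K * dotv e e) ->
  \tr (sigma_mx q *m X) <= K.
Proof.
move=> q0 n1 XK; have n10 : (0 : R) < n%:R - 1 by rewrite subr_gt0 ltr1n.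
rewrite -(ler_pM2l n10) -sum_quadv_row_sigma// mulr_sumr [leRHS]mulrC.
rewrite -[X in _ <= K * X](sum_dotv_row_sigma q0) mulr_sumr; apply: ler_sum => i _.
by apply: XK; exact: row_sigma_orth.
Qed.

Lemma trace_sigma_ge q X K : q != 0 -> (1 < n)%N ->
  (forall e, dotv e q = 0 -> K * dotv e e <= (n%:R - 1) * quadv X e) ->
  K <= \tr (sigma_mx q *m X).
Proof.
move=> q0 n1 XK; rewrite -lerN2 -linearN/= -mulmxN.
apply: trace_sigma_le => // e /XK; rewrite quadvN; lra.
Qed.

(** The topology of row vectors comes from the sup norm, whereas jets are
    measured with the Euclidean norm; the two norms are equivalent. *)
Lemma nbhs_rVP x (A : set 'rV[R]_n) : nbhs x A <->
  exists2 d, 0 < d & forall y, enorm (y - x) < d -> A y.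
Proof.
split.
- move=> /nbhs_ballP[d /= d0 dA]; exists d => // y xyd; apply: dA.
  split=> // i j; rewrite ord1 /ball/= distrC.
  by apply: le_lt_trans xyd; have := coord_le_enorm (y - x) j; rewrite !mxE.
- move=> [d d0 dA]; apply/nbhs_ballP; exists (d / n.+1%:R); first by rewrite /= divr_gt0.
  move=> y [_ xy]; apply: dA.
  apply: (@le_lt_trans _ _ (n%:R * (d / n.+1%:R))).
    apply: enorm_le_coord => [|i]; first by rewrite divr_ge0// ltW.
    by have /ltW := xy 0 i; rewrite /= distrC !mxE.
  by rewrite mulrCA gtr_pMr// ltr_pdivrMr// mul1r ltr_nat.
Qed.

Lemma nbhs_rVRP x t (A : set ('rV[R]_n * R)) : nbhs (x, t) A <->
  exists2 d, 0 < d & forall y s, enorm (y - x) < d -> `|s - t| < d -> A (y, s).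
Proof.
split.
- move=> [[B C] /= [/nbhs_rVP[d d0 dB] /nbhs_ballP[d' /= d'0 dC]] BC].
  exists (Num.min d d'); first by rewrite lt_min d0.
  move=> y s; rewrite !lt_min => /andP[yd _] /andP[_ sd]; apply: BC; split; first exact: dB.
  by apply: dC; rewrite /ball/= distrC.
- move=> [d d0 dA]; exists ([set y | enorm (y - x) < d], [set s | `|s - t| < d]).
    split; first by apply/nbhs_rVP; exists d.
    by apply/nbhs_ballP; exists d => // s; rewrite /ball/= distrC.
  by move=> [y s] [/= yd sd]; exact: dA.
Qed.

Lemma nbhs_rVMP p X (A : set ('rV[R]_n * 'M[R]_n)) : nbhs (p, X) A <->
  exists2 d, 0 < d & forall q Y, enorm (q - p) < d ->
    (forall i j, `|Y i j - X i j| < d) -> A (q, Y).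
Proof.
split.
- move=> [[B C] /= [/nbhs_rVP[d d0 dB] /nbhs_ballP[d' /= d'0 dC]] BC].
  exists (Num.min d d'); first by rewrite lt_min d0.
  move=> y s; rewrite !lt_min => /andP[yd _] sd; apply: BC; split; first exact: dB.
  apply: dC; split=> // i j.
  by have := sd i j; rewrite /ball/= distrC lt_min => /andP[].
- move=> [d d0 dA].
  exists ([set y | enorm (y - p) < d], [set Y : 'M[R]_n | forall i j, `|Y i j - X i j| < d]).
    split; first by apply/nbhs_rVP; exists d.
    apply/nbhs_ballP; exists d => // Y [_ XY] i j.
    by have := XY i j; rewrite /ball/= distrC.
  by move=> [q Y] [/= yd sd]; exact: dA.
Qed.
End Euclidean.

(** * The mean curvature operator and its envelopes *)

Section Operator.
Variables (R : realType) (n : nat).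
Implicit Types (x y z p q e : 'rV[R]_n) (X Y : 'M[R]_n).

Lemma quadv_bound X y M : (forall i j, `|X i j| <= M) ->
  `|quadv X y| <= n%:R ^+ 2 * M * dotv y y.
Proof.
move=> XM; rewrite quadvE; apply: le_trans (ler_norm_sum _ _ _) _.
have -> : n%:R ^+ 2 * M * dotv y y = \sum_(i < n) n%:R * M * dotv y y.
  by rewrite sumr_const card_ord -[RHS]mulr_natl; ring.
apply: ler_sum => i _; apply: le_trans (ler_norm_sum _ _ _) _.
have -> : n%:R * M * dotv y y = \sum_(j < n) M * dotv y y.
  by rewrite sumr_const card_ord -[RHS]mulr_natl; ring.
apply: ler_sum => j _; rewrite -enorm_sqr !normrM mulrAC mulrC expr2.
apply: ler_pM; rewrite ?mulr_ge0//.
by apply: ler_pM => //; exact: coord_le_enorm.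
Qed.

Lemma trace_sigma_bound q X M : q != 0 -> (forall i j, `|X i j| <= M) ->
  `|\tr (sigma_mx q *m X)| <= (n%:R + n%:R ^+ 2) * M.
Proof.
move=> q0 XM; rewrite trace_sigma; apply: le_trans (ler_normB _ _) _.
rewrite mulrDl; apply: lerD.
  rewrite /mxtrace; apply: le_trans (ler_norm_sum _ _ _) _.
  rewrite mulr_natl -[n in _ *+ n]card_ord -sumr_const.
  by apply: ler_sum => i _.
have qq : 0 < dotv q q by rewrite dotvv_gt0.
rewrite normrM normfV (ger0_norm (ltW qq)) mulrC ler_pdivrMr//.
exact: quadv_bound.
Qed.

Lemma entry_bound X : exists M, forall i j, `|X i j| <= M.
Proof.
exists (\sum_i \sum_j `|X i j|) => i j.
rewrite (bigD1 i)//= (bigD1 j)//= -addrA lerDl.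
by rewrite addr_ge0// !sumr_ge0// => k _; rewrite sumr_ge0.
Qed.

(** The operator stays bounded when the gradient tends to zero, because the
    projection depends on the direction of the gradient only; hence its
    envelopes are finite. *)
Lemma Hop_bounded p X : bounded_near (@Hop R n) (within (@Hdom R n) (nbhs (p, X))).
Proof.
have [M XM] := entry_bound X.
apply: (@bounded_near_le _ _ _ _ ((n%:R + n%:R ^+ 2) * (M + 1) + (enorm p + 1))).
apply/nbhs_rVMP; exists 1 => // q Y qp YX [/= q0 _].
rewrite /Hop; apply: le_trans (ler_normB _ _) _; rewrite normrN /=.
apply: lerD.
  apply: trace_sigma_bound => // i j.
  rewrite -(subrK (X i j) (Y i j)) addrC; apply: le_trans (ler_normD _ _) _.
  by rewrite lerD// ltW.
rewrite ger0_norm ?enorm_ge0// -{1}(subrK p q) addrC.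
by apply: le_trans (enormD _ _) _; rewrite lerD2l ltW.
Qed.

Lemma nonzero_rV : (0 < n)%N -> exists q : 'rV[R]_n, q != 0.
Proof.
move=> n0; exists (const_mx 1); apply/eqP => /rowP/(_ (Ordinal n0)).
by rewrite !mxE => /eqP; rewrite oner_eq0.
Qed.

Lemma sigmaZ a q : a != 0 -> sigma_mx (a *: q) = sigma_mx q.
Proof.
move=> a0; rewrite /sigma_mx enormZ exprMn real_normK ?num_real//.
have -> : (a *: q)^T *m (a *: q) = a ^+ 2 *: (q^T *m q).
  by apply/matrixP => i j; rewrite !mxE !big_ord1 !mxE; ring.
by rewrite scalerA invfM mulrAC mulVf ?mul1r// expf_eq0/= (negbTE a0).
Qed.

(** [p] is either regular, and then [q = p], or singular, and then every direction
    [q] is the limit of gradients converging to [p]. *)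
Definition gradient_dir p q := q != 0 /\ (p = 0 \/ p = q).

Lemma gradient_dir_approx p q d : gradient_dir p q -> 0 < d -> exists w,
  [/\ w != 0, enorm (w - p) < d, enorm p <= enorm w & sigma_mx w = sigma_mx q].
Proof.
move=> [q0 [-> | ->]] d0; last first.
  by exists q; rewrite subrr enorm0.
have qg : 0 < enorm q by rewrite enorm_gt0.
have a0 : 0 < d / 2 / enorm q by rewrite !divr_gt0.
exists ((d / 2 / enorm q) *: q).
rewrite scaler_eq0 (negbTE q0) orbF gt_eqF// subr0 enorm0 enorm_ge0 sigmaZ ?gt_eqF//.
rewrite enormZ gtr0_norm// divfK ?gt_eqF//; split=> //; lra.
Qed.

Lemma Hdom_proper p X : (0 < n)%N -> X^T = X ->
  ProperFilter (within (@Hdom R n) (nbhs (p, X))).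
Proof.
move=> n0 sX; apply: within_nbhs_proper => A /nbhs_rVMP[d d0 dA].
have [q [q0 qp]] : exists q, gradient_dir p q.
  have [p0|p0] := eqVneq p 0; last by exists p; split=> //; right.
  by have [q q0] := nonzero_rV n0; exists q; split=> //; left.
have [w [w0 wp _ _]] := gradient_dir_approx (conj q0 qp) d0.
exists (w, X); split; first by split.
by apply: dA => // i j; rewrite subrr normr0.
Qed.

(** Along gradients tending to [p] in the direction [q] the operator tends to the
    right-hand side, which therefore bounds the lower envelope from above and,
    in the next lemma, the upper envelope from below. *)
Lemma H_lower_le p q X : (0 < n)%N -> X^T = X -> gradient_dir p q ->
  H_lower p X <= - \tr (sigma_mx q *m X) - enorm p.
Proof.
move=> n0 sX pq; rewrite leNgt; apply/negP.
have FF := @Hdom_proper p X n0 sX.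
move=> /(lower_env_gt FF (Hop_bounded p X)).
move=> /nbhs_rVMP[d d0 dH].
have [w [w0 wp pw sw]] := gradient_dir_approx pq d0.
have := dH w X wp; rewrite /Hop/= sw => H.
have {H} := H (fun i j => _) (conj w0 sX).
have e i j : `|X i j - X i j| < d by rewrite subrr normr0.
move=> /(_ e); lra.
Qed.

Lemma H_upper_ge p q X : (0 < n)%N -> X^T = X -> gradient_dir p q ->
  - \tr (sigma_mx q *m X) - enorm p <= H_upper p X.
Proof.
move=> n0 sX pq; apply/ler_addgt0Pr => e e0.
have FF := @Hdom_proper p X n0 sX.
have : H_upper p X < H_upper p X + e / 2 by rewrite ltrDl divr_gt0.
move=> /(upper_env_lt FF (Hop_bounded p X)).
move=> /nbhs_rVMP[d d0 dH].
have me : 0 < Num.min d (e / 2) by rewrite lt_min d0 divr_gt0.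
have [w [w0 wp pw sw]] := gradient_dir_approx pq me.
move: wp; rewrite lt_min => /andP[wp we].
have eX i j : `|X i j - X i j| < d by rewrite subrr normr0.
have := dH w X wp eX (conj w0 sX); rewrite /Hop/= sw.
have : enorm w <= enorm (w - p) + enorm p by rewrite -{1}(subrK p w) enormD.
lra.
Qed.

Lemma quadv_cvg X p : quadv X q @[q --> p] --> quadv X p.
Proof.
under eq_cvg do rewrite quadvE; rewrite quadvE.
have sumc (f : 'I_n -> 'rV[R]_n -> R) : (forall i, f i q @[q --> p] --> f i p) ->
    \sum_i f i q @[q --> p] --> \sum_i f i p.
  by move=> fc; exact: (@cvg_big R _ _ _ _ (@add_continuous R) _ (nbhs p) _ f).
have coord i : q 0 i @[q --> p] --> p 0 i by exact: coord_continuous.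
apply: (sumc (fun i q => \sum_j q 0 i * X i j * q 0 j)) => i.
apply: (sumc (fun j q => q 0 i * X i j * q 0 j)) => j.
have FF : Filter (nbhs p) by exact: nbhs_filter.
exact: (cvgM (FF := FF) (cvgM (FF := FF) (coord i) (cvg_cst _)) (coord j)).
Qed.

(** At a nonzero gradient the operator is continuous. *)
Lemma H_lower_ge p X : (0 < n)%N -> X^T = X -> p != 0 ->
  - \tr (sigma_mx p *m X) - enorm p <= H_lower p X.
Proof.
move=> n0 sX p0; have FF := @Hdom_proper p X n0 sX.
apply/ler_addgt0Pr => e e0; rewrite -lerBlDr.
apply: lower_env_ge; first exact: Hop_bounded.
have qc : (fun q => (dotv q q)^-1 * quadv X q) @ p --> (dotv p p)^-1 * quadv X p.
  have FP : Filter (nbhs p) by exact: nbhs_filter.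
  have dc : dotv q q @[q --> p] --> dotv p p.
    by rewrite -quadv1; under eq_cvg do rewrite -quadv1; exact: quadv_cvg.
  apply: (cvgM (FF := FP) (cvgV (FF := FP) _ dc) (@quadv_cvg X p)).
  by rewrite dotvv_eq0.
have C0 : 0 < n%:R + n%:R ^+ 2 :> R by rewrite addr_gt0 ?exprn_gt0 ?ltr0n.
have /nbhs_rVP[d d0 dq] : \forall q \near p,
   `|(dotv p p)^-1 * quadv X p - (dotv q q)^-1 * quadv X q| < e / 3.
  by move/cvgrPdist_lt : qc; apply; rewrite divr_gt0.
apply/nbhs_rVMP; exists (Num.min d (Num.min (e / 3) (e / 3 / (n%:R + n%:R ^+ 2)))).
  by rewrite !lt_min d0 !divr_gt0.
move=> q Y; rewrite !lt_min => /and3P[qd qe qC] YX [/= q0 _].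
rewrite /Hop/=.
have : \tr (sigma_mx q *m (Y - X)) <= e / 3.
  apply: le_trans (ler_norm _) _.
  apply: le_trans (trace_sigma_bound (M := e / 3 / (n%:R + n%:R ^+ 2)) q0 _) _.
    by move=> i j; have := YX i j; rewrite !mxE !lt_min => /and3P[_ _ /ltW].
  by rewrite mulrC divfK ?gt_eqF.
rewrite mulmxBr linearB/=.
have : enorm q <= enorm (q - p) + enorm p by rewrite -{1}(subrK p q) enormD.
have := dq q qd; rewrite !trace_sigma ltr_norml => /andP[].
lra.
Qed.

(** The curvature term of a scalar matrix is the same for all gradient directions,
    so the singularity at the zero gradient is harmless for it. *)
Lemma H_lower_scalar c : (0 < n)%N ->
  - (c * (n%:R - 1)) <= H_lower (0 : 'rV[R]_n) c%:M.
Proof.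
move=> n0; have sX : (c%:M : 'M[R]_n)^T = c%:M by rewrite tr_scalar_mx.
have FF := @Hdom_proper 0 c%:M n0 sX.
apply/ler_addgt0Pr => e e0; rewrite -lerBlDr.
apply: lower_env_ge; first exact: Hop_bounded.
have C0 : 0 < n%:R + n%:R ^+ 2 :> R by rewrite addr_gt0 ?exprn_gt0 ?ltr0n.
apply/nbhs_rVMP; exists (Num.min (e / 2) (e / 2 / (n%:R + n%:R ^+ 2))).
  by rewrite !lt_min !divr_gt0.
move=> q Y; rewrite !lt_min subr0 => /andP[qe qC] YX [/= q0 _].
rewrite /Hop/=.
have : \tr (sigma_mx q *m (Y - c%:M)) <= e / 2.
  apply: le_trans (ler_norm _) _.
  apply: le_trans (trace_sigma_bound (M := e / 2 / (n%:R + n%:R ^+ 2)) q0 _) _.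
    by move=> i j; have := YX i j; rewrite !mxE !lt_min => /andP[_ /ltW].
  by rewrite mulrC divfK ?gt_eqF.
rewrite mulmxBr linearB/= mul_mx_scalar linearZ/= trace_sigma1//; lra.
Qed.
End Operator.

(** * Touching radial functions from above *)

Section Jets.
Variables (R : realType) (n : nat).
Implicit Types (x y z p q e : 'rV[R]_n) (X Y : 'M[R]_n) (w : 'rV[R]_n * R -> R).

Lemma superjetP w x0 t0 p X tau : superjet w x0 t0 p X tau <->
  X^T = X /\ forall eps, 0 < eps -> exists2 d, 0 < d & forall x t,
    enorm (x - x0) < d -> `|t - t0| < d ->
    w (x, t) <= w (x0, t0) + tau * (t - t0) + dotv p (x - x0)
      + 2^-1 * quadv X (x - x0) + eps * (`|t - t0| + enorm (x - x0) ^+ 2).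
Proof.
split=> -[sX jet]; split=> // eps /jet.
  by move=> /nbhs_rVRP[d d0 H]; exists d => // x t xd td; exact: H.
by move=> [d d0 H]; apply/nbhs_rVRP; exists d => // x t xd td; exact: H.
Qed.

(** The equation for [a] is the second-order expansion of the square root, with
    the remainder expressed through the root itself. *)
Lemma sqrt1D (k : R) : `|k| <= 1 -> exists2 a : R,
  (1 + a) ^+ 2 = 1 + k & `|a| <= `|k| /\ a = k / 2 - a ^+ 2 / 2.
Proof.
rewrite ler_norml => /andP[k1 _]; exists (Num.sqrt (1 + k) - 1).
  by rewrite addrC subrK sqr_sqrtr//; lra.
set s := Num.sqrt _; have s0 : 0 <= s by exact: sqrtr_ge0.
have s2 : s ^+ 2 = 1 + k by rewrite sqr_sqrtr//; lra.
have -> : k = s ^+ 2 - 1 by rewrite s2; ring.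
split; last by field.
have -> : s ^+ 2 - 1 = (s - 1) * (s + 1) by ring.
by rewrite normrM ler_peMr// ger0_norm; lra.
Qed.

Lemma quadv_comb X x e a c : quadv X (a *: x + c *: e) =
  a ^+ 2 * quadv X x + a * c * (dotv (x *m X) e + dotv (e *m X) x) + c ^+ 2 * quadv X e.
Proof. by rewrite /quadv mulmxDl -!scalemxAl !dotvE; ring. Qed.

Let b2 : R := 2 * (n%:R - 1).
Let b : R := Num.sqrt b2.

(** The test points of the touching argument: during a time [th ^+ 2] move by
    [b * th] in a tangential direction [e], then rescale so that the squared norm
    has changed by [(b2 + kap) * th ^+ 2]. A tangential displacement of the order
    of the square root of time makes the second derivative of the test function
    count as much as its first derivatives, exactly as in the deterministic games
    for mean curvature flow; [kap] encodes the radial speed. *)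
Lemma jet_expand w x0 t0 p X tau e (K : R) : (1 < n)%N -> x0 != 0 -> 0 < K ->
  dotv e x0 = 0 -> dotv e e = 1 -> superjet w x0 t0 p X tau ->
  exists2 C, 0 < C & forall eps, 0 < eps -> eps <= 1 ->
  exists2 d, 0 < d & forall th kap t', 0 < th -> th < d -> `|kap| <= K ->
    `|t' - (t0 - th ^+ 2)| <= eps * th ^+ 2 ->
    exists2 x', dotv x' x' = dotv x0 x0 + (b2 + kap) * th ^+ 2 &
      w (x', t') <= w (x0, t0) + b * th * dotv p e
        + th ^+ 2 * (- tau + kap / (2 * dotv x0 x0) * dotv p x0
                     + (n%:R - 1) * quadv X e + C * eps).
Proof.
move=> n1 x00 K0 ex0 ee /superjetP[sX jet].
have b20 : 0 < b2 by rewrite mulr_gt0// subr_gt0 ltr1n.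
have b0 : 0 < b by rewrite sqrtr_gt0.
have bb : b ^+ 2 = b2 by rewrite sqr_sqrtr// ltW.
have s0 : 0 < dotv x0 x0 by rewrite dotvv_gt0.
set s := dotv x0 x0 in s0 *.
set P := dotv p x0; set Q := quadv X x0; set B := dotv (x0 *m X) e + dotv (e *m X) x0.
pose C2 := `|P| * (K / s) ^+ 2 + (K / s) ^+ 2 * `|Q| + K / s * b * `|B| + K ^+ 2 / s.
have Ks : 0 < K / s by rewrite divr_gt0.
have C20 : 0 <= C2.
  by rewrite /C2 !addr_ge0// ?mulr_ge0// ?sqr_ge0// ?invr_ge0// ltW.
have C21 : 0 < C2 + 1 by rewrite ltr_wpDl.
exists (`|tau| + 3 + b2) => [|eps eps0 eps1]; first by have := normr_ge0 tau; lra.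
have [d d0 {}jet] := jet eps eps0.
pose D := 1 + K / s + K ^+ 2 / s + b2.
have D1 : 1 <= D by rewrite /D -!addrA lerDl !addr_ge0// ?divr_ge0// ?sqr_ge0// ltW.
have D0 : 0 <= D by exact: le_trans D1.
have D10 : 0 < D + 1 by rewrite ltr_wpDl.
exists (Num.min (Num.min 1 (eps / (C2 + 1))) (Num.min (d / (D + 1)) (s / K))).
  by rewrite !lt_min ltr01 !divr_gt0.
move=> th kap t' th0; rewrite !lt_min => /andP[/andP[th1 the] /andP[thd thK]] kK tt.
have th21 : th ^+ 2 <= th by rewrite expr2 ler_piMr// ltW.
have th20 : 0 < th ^+ 2 by rewrite exprn_gt0.
pose k := kap * th ^+ 2 / s.
have kle : `|k| <= K / s * th ^+ 2.
  rewrite /k normrM normfV (gtr0_norm s0) normrM (gtr0_norm th20) mulrAC.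
  by rewrite ler_pM2r// ler_pM2r ?invr_gt0.
have k1 : `|k| <= 1.
  apply: le_trans kle _; apply: le_trans (ler_wpM2l (ltW Ks) th21) _.
  by move: thK; rewrite ltr_pdivlMr// => /ltW; rewrite mulrAC ler_pdivrMr// mul1r mulrC.
have [a a1 [ak aE]] := sqrt1D k1.
have aKs : `|a| <= K / s * th ^+ 2 by exact: le_trans kle.
have a2 : a ^+ 2 <= (K / s) ^+ 2 * th ^+ 4.
  have -> : (K / s) ^+ 2 * th ^+ 4 = (K / s * th ^+ 2) ^+ 2 by ring.
  by rewrite -real_normK ?num_real// ler_pXn2r ?nnegrE// mulr_ge0// ltW.
have th43 : th ^+ 4 <= th ^+ 3 by rewrite exprS ler_piMl ?exprn_ge0// ltW.
pose y := a *: x0 + (b * th) *: e.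
have yy : enorm y ^+ 2 = a ^+ 2 * s + b2 * th ^+ 2.
  by rewrite enorm_sqr /y !dotvE (dotvC x0) ex0 ee -/s -bb; ring.
exists (x0 + y).
  rewrite /y !dotvE (dotvC x0 e) ex0 ee -/s.
  have -> : (b2 + kap) * th ^+ 2 = b2 * th ^+ 2 + k * s by rewrite /k divfK ?gt_eqF//; ring.
  have -> : k = (1 + a) ^+ 2 - 1 by rewrite a1; ring.
  by rewrite -bb; ring.
have as2 : a ^+ 2 * s <= K ^+ 2 / s * th ^+ 3.
  have -> : K ^+ 2 / s * th ^+ 3 = (K / s) ^+ 2 * th ^+ 3 * s by field; rewrite gt_eqF.
  rewrite ler_pM2r//; apply: le_trans a2 _.
  by rewrite ler_wpM2l// sqr_ge0.
have th32 : th ^+ 3 <= th ^+ 2 by rewrite exprS ler_piMl ?exprn_ge0// ltW.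
have Dth : D * th < d.
  move: thd; rewrite ltr_pdivlMr//; apply: le_lt_trans.
  by rewrite mulrC ler_wpM2l ?(ltW th0)// lerDl.
have ynear : enorm (x0 + y - x0) < d.
  rewrite addrC addKr; apply: le_lt_trans Dth.
  rewrite -(@ler_pXn2r _ 2) ?nnegrE ?enorm_ge0//; last by rewrite mulr_ge0// ltW.
  rewrite yy exprMn.
  apply: (@le_trans _ _ (D * th ^+ 2)).
    rewrite /D; have : K ^+ 2 / s * th ^+ 3 <= K ^+ 2 / s * th ^+ 2.
      by rewrite ler_wpM2l// divr_ge0 ?sqr_ge0// ltW.
    have : 0 <= K / s * th ^+ 2 by rewrite mulr_ge0// ltW.
    lra.
  have D2 : D <= D ^+ 2 by rewrite expr2 ler_peMr.
  by rewrite ler_wpM2r// ltW.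
have tnear : `|t' - t0| < d.
  have -> : t' - t0 = (t' - (t0 - th ^+ 2)) - th ^+ 2 by ring.
  apply: le_lt_trans (ler_normB _ _) _; rewrite (gtr0_norm th20).
  have : eps * th ^+ 2 <= th ^+ 2 by rewrite ler_piMl// ltW.
  have : 1 * th <= D * th by rewrite ler_wpM2r// ltW.
  have : th * D + th < d by move: thd; rewrite ltr_pdivlMr// mulrDr mulr1.
  lra.
have {jet} := jet (x0 + y) t' ynear tnear.
rewrite [x0 + y - x0]addrC addKr => jet; apply: le_trans jet _.
rewrite yy.
have F1 : tau * (t' - t0) <= - tau * th ^+ 2 + `|tau| * (eps * th ^+ 2).
  have -> : tau * (t' - t0) = - tau * th ^+ 2 + tau * (t' - (t0 - th ^+ 2)) by ring.
  rewrite lerD2l; apply: le_trans (ler_norm _) _.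
  by rewrite normrM ler_wpM2l.
have F2 : dotv p y <= b * th * dotv p e + th ^+ 2 * (kap / (2 * s) * P)
    + `|P| * (K / s) ^+ 2 * th ^+ 3.
  have -> : dotv p y = b * th * dotv p e + th ^+ 2 * (kap / (2 * s) * P) - a ^+ 2 / 2 * P.
    rewrite /y !dotvE -/P {1}aE /k; field; exact: lt0r_neq0.
  rewrite lerD2l; apply: le_trans (ler_norm _) _.
  rewrite normrN normrM ger0_norm ?divr_ge0 ?sqr_ge0// mulrC -mulrA ler_wpM2l//.
  apply: (@le_trans _ _ (a ^+ 2)); first by have := sqr_ge0 a; lra.
  by apply: le_trans a2 _; rewrite ler_wpM2l// sqr_ge0.
have F3 : quadv X y <= b2 * th ^+ 2 * quadv X e + (K / s) ^+ 2 * `|Q| * th ^+ 3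
    + K / s * b * `|B| * th ^+ 3.
  rewrite /y quadv_comb -/Q -/B.
  have : a ^+ 2 * Q <= (K / s) ^+ 2 * `|Q| * th ^+ 3.
    apply: le_trans (ler_norm _) _; rewrite normrM ger0_norm ?sqr_ge0//.
    rewrite [leRHS]mulrAC ler_wpM2r//; apply: le_trans a2 _.
    by rewrite ler_wpM2l// sqr_ge0.
  have : a * (b * th) * B <= K / s * b * `|B| * th ^+ 3.
    apply: le_trans (ler_norm _) _; rewrite !normrM (gtr0_norm b0) (gtr0_norm th0).
    have -> : K / s * b * `|B| * th ^+ 3 = K / s * th ^+ 2 * (b * th) * `|B| by ring.
    apply: ler_wpM2r => //; apply: ler_wpM2r => //.
    by rewrite mulr_ge0// ltW.
  by rewrite (exprMn _ b th) bb; lra.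
have F4 : eps * `|t' - t0| <= eps * (2 * th ^+ 2).
  rewrite ler_wpM2l ?(ltW eps0)//.
  have -> : t' - t0 = (t' - (t0 - th ^+ 2)) - th ^+ 2 by ring.
  apply: le_trans (ler_normB _ _) _; rewrite (gtr0_norm th20).
  have : eps * th ^+ 2 <= th ^+ 2 by rewrite ler_piMl// ltW.
  lra.
have F5 : C2 * th ^+ 3 <= eps * th ^+ 2.
  have -> : C2 * th ^+ 3 = C2 * th * th ^+ 2 by ring.
  rewrite ler_wpM2r ?(ltW th20)//.
  move: the; rewrite ltr_pdivlMr// => /ltW; apply: le_trans.
  by rewrite mulrC ler_wpM2l ?(ltW th0)// lerDl.
have F6 : eps * (a ^+ 2 * s) <= K ^+ 2 / s * th ^+ 3.
  by apply: le_trans as2; rewrite ler_piMl// mulr_ge0 ?sqr_ge0// ltW.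
have th30 : 0 <= th ^+ 3 by rewrite exprn_ge0// ltW.
have F7 : 0 <= (K / s) ^+ 2 * `|Q| * th ^+ 3 by rewrite mulr_ge0// mulr_ge0// sqr_ge0.
have F8 : 0 <= K / s * b * `|B| * th ^+ 3 by rewrite mulr_ge0// mulr_ge0// mulr_ge0// ltW.
have Eb2 : b2 = 2 * (n%:R - 1) by [].
move: F5; rewrite /C2; move: F1 F2 F3 F4 F6 F7 F8; clear -Eb2; rewrite Eb2.
lra.
Qed.

(** At the origin every direction is tangential, and the whole displacement goes
    in the direction [e]. *)
Lemma jet_expand0 w t0 p X tau e : (1 < n)%N ->
  dotv e e = 1 -> superjet w 0 t0 p X tau ->
  exists2 C, 0 < C & forall eps, 0 < eps -> eps <= 1 ->
  exists2 d, 0 < d & forall th kap t', 0 < th -> th < d -> `|kap| <= b2 ->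
    `|t' - (t0 - th ^+ 2)| <= eps * th ^+ 2 ->
    exists2 x', dotv x' x' = (b2 + kap) * th ^+ 2 &
      w (x', t') <= w (0, t0) + Num.sqrt (b2 + kap) * th * dotv p e
        + th ^+ 2 * (- tau + (b2 + kap) / 2 * quadv X e + C * eps).
Proof.
move=> n1 ee /superjetP[sX jet].
have b20 : 0 < b2 by rewrite mulr_gt0// subr_gt0 ltr1n.
exists (`|tau| + 3 + 2 * b2) => [|eps eps0 eps1]; first by have := normr_ge0 tau; lra.
have [d d0 {}jet] := jet eps eps0.
exists (Num.min 1 (d / (2 + 2 * b2))).
  by rewrite lt_min ltr01 divr_gt0//; lra.
move=> th kap t' th0; rewrite lt_min => /andP[th1 thd] kb tt.
have th21 : th ^+ 2 <= th by rewrite expr2 ler_piMr// ltW.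
have th20 : 0 < th ^+ 2 by rewrite exprn_gt0.
have Dth : (2 + 2 * b2) * th < d by move: thd; rewrite ltr_pdivlMr; lra.
have [kb1 kb2] : - b2 <= kap /\ kap <= b2 by move: kb; rewrite ler_norml => /andP[].
have bk : Num.sqrt (b2 + kap) ^+ 2 = b2 + kap by rewrite sqr_sqrtr//; lra.
pose y := (Num.sqrt (b2 + kap) * th) *: e.
have yy : dotv y y = (b2 + kap) * th ^+ 2 by rewrite /y !dotvE ee -[in RHS]bk; ring.
exists y => //.
have bth : 0 <= b2 * th by rewrite mulr_ge0// ltW.
have ynear : enorm (y - 0) < d.
  rewrite subr0; apply: le_lt_trans Dth.
  rewrite -(@ler_pXn2r _ 2) ?nnegrE ?enorm_ge0//; last by lra.
  rewrite enorm_sqr yy exprMn ler_wpM2r ?(ltW th20)//.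
  have -> : (2 + 2 * b2) ^+ 2 = 4 + 8 * b2 + 4 * b2 ^+ 2 by ring.
  by have := sqr_ge0 b2; lra.
have t'0 : `|t' - t0| <= 2 * th ^+ 2.
  have -> : t' - t0 = (t' - (t0 - th ^+ 2)) - th ^+ 2 by ring.
  apply: le_trans (ler_normB _ _) _; rewrite (gtr0_norm th20).
  have : eps * th ^+ 2 <= th ^+ 2 by rewrite ler_piMl// ltW.
  lra.
have tnear : `|t' - t0| < d by lra.
have {jet} := jet y t' ynear tnear.
rewrite subr0 => jet; apply: le_trans jet _.
rewrite enorm_sqr yy {1}/y dotvZr /y quadvZ exprMn bk.
have F1 : tau * (t' - t0) <= - tau * th ^+ 2 + `|tau| * (eps * th ^+ 2).
  have -> : tau * (t' - t0) = - tau * th ^+ 2 + tau * (t' - (t0 - th ^+ 2)) by ring.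
  rewrite lerD2l; apply: le_trans (ler_norm _) _.
  by rewrite normrM ler_wpM2l.
have F2 : eps * `|t' - t0| <= eps * (2 * th ^+ 2) by rewrite ler_wpM2l// ltW.
have F3 : eps * ((b2 + kap) * th ^+ 2) <= eps * (2 * b2 * th ^+ 2).
  by rewrite ler_wpM2l ?(ltW eps0)// ler_wpM2r ?(ltW th20)//; lra.
have F4 : 0 <= eps * th ^+ 2 by rewrite mulr_ge0// ltW.
move: F1 F2 F3 F4; clear; lra.
Qed.

(** Divide by [th] and let it tend to zero; when [A] vanishes, divide by
    [th ^+ 2] instead. *)
Lemma second_order_sign (A B C : R) : 0 < C ->
  (forall eps, 0 < eps -> eps <= 1 -> exists2 d, 0 < d &
    forall th, 0 < th -> th < d -> 0 <= th * A + th ^+ 2 * (B + C * eps)) ->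
  0 <= A /\ (A = 0 -> 0 <= B).
Proof.
move=> C0 H; split.
  rewrite leNgt; apply/negP => A0.
  have [d d0 {}H] := H 1 ltr01 (lexx _).
  have BC : 0 < `|B| + C + 1 by rewrite addr_gt0// ltr_wpDl.
  pose th := Num.min (d / 2) (- A / 2 / (`|B| + C + 1)).
  have th0 : 0 < th by rewrite lt_min !divr_gt0// oppr_gt0.
  have thd : th < d by rewrite gt_min; apply/orP; left; lra.
  have thA : th * (`|B| + C + 1) <= - A / 2.
    by rewrite -ler_pdivlMr// ge_min lexx orbT.
  have := H th th0 thd.
  have -> : th * A + th ^+ 2 * (B + C * 1) = th * (A + th * (B + C)) by ring.
  rewrite pmulr_rge0//.
  have : th * B <= th * `|B| by rewrite ler_wpM2l ?ler_norm// ltW.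
  lra.
move=> A0; rewrite leNgt; apply/negP => B0.
pose eps := Num.min 1 (- B / 2 / C).
have eps0 : 0 < eps by rewrite lt_min ltr01 !divr_gt0// oppr_gt0.
have eps1 : eps <= 1 by rewrite ge_min lexx.
have epsB : C * eps <= - B / 2 by rewrite mulrC -ler_pdivlMr// ge_min lexx orbT.
have [d d0 {}H] := H eps eps0 eps1.
have d2 : 0 < d / 2 by lra.
have d2d : d / 2 < d by lra.
have := H (d / 2) d2 d2d; rewrite A0 mulr0 add0r pmulr_rge0 ?exprn_gt0//.
lra.
Qed.

Lemma unit_vector e : e != 0 -> exists2 e', dotv e' e' = 1 & e = enorm e *: e'.
Proof.
move=> e0; have en : enorm e != 0 by rewrite enorm_eq0.
exists ((enorm e)^-1 *: e); last by rewrite scalerA mulfV// scale1r.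
by rewrite !dotvE -enorm_sqr expr2 (mulrA _ (enorm e)) mulVf// mul1r mulVf.
Qed.

Lemma parallel_of_orth x0 p : x0 != 0 ->
  (forall e, dotv e x0 = 0 -> dotv p e = 0) -> exists c, p = c *: x0.
Proof.
move=> x00 H; have s0 : dotv x0 x0 != 0 by rewrite dotvv_eq0.
exists (dotv p x0 / dotv x0 x0); set c := _ / _; apply/eqP; rewrite -subr_eq0 -dotvv_eq0.
have ex : dotv (p - c *: x0) x0 = 0 by rewrite !dotvE /c divfK// subrr.
by rewrite {1}dotvDl dotvNl dotvZl H// (dotvC x0) ex mulr0 subr0.
Qed.

Lemma tangential_dir x0 p : (0 < n)%N ->
  (forall e, dotv e x0 = 0 -> dotv p e = 0) ->
  exists2 q, gradient_dir p q & forall e, dotv e q = 0 -> dotv e x0 = 0.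
Proof.
move=> n0 H; have [x00|x00] := eqVneq x0 0.
  have p0 : p = 0.
    by apply/eqP; rewrite -dotvv_eq0 H// x00 dotv0r.
  have [q q0] := nonzero_rV R n0; exists q; first by split=> //; left.
  by move=> e _; rewrite x00 dotv0r.
have [c pc] := parallel_of_orth x00 H.
have [p0|p0] := eqVneq p 0; first by exists x0 => //; split=> //; left.
exists p; first by split=> //; right.
have c0 : c != 0 by apply: contraNneq p0 => c0; rewrite pc c0 scale0r.
by move=> e /eqP; rewrite pc dotvZr mulf_eq0 (negbTE c0) => /eqP.
Qed.

(** The dynamic programming hypothesis only prescribes the norm of the point which
    is reached, so its tangential displacement may be chosen freely: both [e] and
    [- e] are possible, which removes the tangential part of the gradient. At the
    next order the radial motion contributes at most [enorm p] and the tangential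
    one the second derivative in the direction [e]. *)
Lemma superjet_radial w x0 t0 p X tau m : (1 < n)%N ->
  superjet w x0 t0 p X tau ->
  (forall eps, 0 < eps -> exists2 d, 0 < d & forall th, 0 < th -> th < d ->
    exists s' t', [/\ `|t' - (t0 - th ^+ 2)| <= eps * th ^+ 2,
      `|s' - dotv x0 x0 - b2 * th ^+ 2| <= (2 * enorm x0 + eps) * th ^+ 2 &
      forall x', dotv x' x' = s' -> w (x0, t0) <= w (x', t') + th ^+ 2 * (m + eps)]) ->
  forall e, dotv e x0 = 0 ->
    dotv p e = 0 /\ (tau - m - enorm p) * dotv e e <= (n%:R - 1) * quadv X e.
Proof.
move=> n1 jet dpp.
have b20 : 0 < b2 by rewrite mulr_gt0// subr_gt0 ltr1n.
have b0 : 0 < b by rewrite sqrtr_gt0.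
suff unit_case e : dotv e x0 = 0 -> dotv e e = 1 ->
    0 <= dotv p e /\ (dotv p e = 0 -> 0 <= m - tau + enorm p + (n%:R - 1) * quadv X e).
  move=> e ex; have [->|e0] := eqVneq e 0.
    by rewrite /quadv mul0mx !dotvE !mulr0.
  have [e' e'1 eE] := unit_vector e0.
  have en : enorm e != 0 by rewrite enorm_eq0.
  have e'x : dotv e' x0 = 0.
    by move: ex; rewrite eE dotvZl => /eqP; rewrite mulf_eq0 (negbTE en) => /eqP.
  have [pe He] := unit_case e' e'x e'1.
  have [||pe' _] := unit_case (- e').
  - by rewrite dotvNl e'x oppr0.
  - by rewrite dotvNl dotvNr opprK.
  have pe0 : dotv p e' = 0 by move: pe'; rewrite dotvNr; lra.
  rewrite eE dotvZr pe0 mulr0 quadvZ !dotvE e'1; split=> //.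
  have := He pe0; rewrite -(pmulr_rge0 _ (_ : 0 < enorm e ^+ 2)); last first.
    by rewrite exprn_gt0// enorm_gt0.
  lra.
move=> ex ee; have [x00|x00] := eqVneq x0 0; last first.
  have r0 : 0 < enorm x0 by rewrite enorm_gt0.
  have s0 : 0 < dotv x0 x0 by rewrite dotvv_gt0.
  have K0 : 0 < 2 * enorm x0 + 1 by lra.
  have [C C0 exp] := jet_expand n1 x00 K0 ex ee jet.
  have C'0 : 0 < C + 1 + enorm p / (2 * enorm x0).
    by rewrite ltr_wpDr ?divr_ge0 ?enorm_ge0//; lra.
  have key : forall eps, 0 < eps -> eps <= 1 -> exists2 d, 0 < d &
    forall th, 0 < th -> th < d -> 0 <= th * (b * dotv p e) +
      th ^+ 2 * (m - tau + enorm p + (n%:R - 1) * quadv X e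
        + (C + 1 + enorm p / (2 * enorm x0)) * eps).
    move=> eps eps0 eps1.
    have [d d0 {}exp] := exp eps eps0 eps1.
    have [d' d'0 {}dpp] := dpp eps eps0.
    exists (Num.min d d'); first by rewrite lt_min d0.
    move=> th th0; rewrite lt_min => /andP[thd thd'].
    have [s' [t' [tt ss wx]]] := dpp th th0 thd'.
    have th20 : 0 < th ^+ 2 by rewrite exprn_gt0.
    pose kap := (s' - dotv x0 x0 - b2 * th ^+ 2) / th ^+ 2.
    have kapth : kap * th ^+ 2 = s' - dotv x0 x0 - b2 * th ^+ 2.
      by rewrite /kap divfK// gt_eqF.
    have kle : `|kap| <= 2 * enorm x0 + eps.
      by rewrite -(ler_pM2r th20) -{1}(gtr0_norm th20) -normrM kapth.
    have kK : `|kap| <= 2 * enorm x0 + 1 by lra.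
    have [x' xx' wx'] := exp th kap t' th0 thd kK tt.
    have := wx x'; rewrite xx' mulrDl kapth => /(_ (ltac:(ring))).
    have : kap / (2 * dotv x0 x0) * dotv p x0 <=
        enorm p + enorm p / (2 * enorm x0) * eps.
      apply: le_trans (ler_norm _) _; rewrite normrM normrM normfV.
      rewrite (@gtr0_norm _ (2 * dotv x0 x0)); last by lra.
      apply: (@le_trans _ _ ((2 * enorm x0 + eps) / (2 * dotv x0 x0) *
         (enorm p * enorm x0))).
        apply: ler_pM => //; last exact: cauchy_schwarz.
          by rewrite divr_ge0//; lra.
        by rewrite ler_pM2r// invr_gt0; lra.
      rewrite -enorm_sqr le_eqVlt; apply/orP; left; apply/eqP.
      by field; rewrite gt_eqF.
    rewrite -(ler_pM2l th20) => H1 H2.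
    move: H1 H2 wx'; clear; lra.
  have [A B] := second_order_sign C'0 key.
  split; first by rewrite pmulr_rge0 in A.
  by move=> pe; apply: B; rewrite pe mulr0.
rewrite x00 in jet dpp *; rewrite enorm0 dotv0l mulr0 in dpp.
have dpp' eps : 0 < eps -> exists2 d, 0 < d & forall th, 0 < th -> th < d ->
    exists kap t', [/\ `|t' - (t0 - th ^+ 2)| <= eps * th ^+ 2, `|kap| <= eps &
      forall x', dotv x' x' = (b2 + kap) * th ^+ 2 ->
        w (0, t0) <= w (x', t') + th ^+ 2 * (m + eps)].
  move=> eps0; have [d d0 {}dpp] := dpp eps eps0; exists d => // th th0 thd.
  have [s' [t' [tt ss wx]]] := dpp th th0 thd.
  have th20 : 0 < th ^+ 2 by rewrite exprn_gt0.
  pose kap := s' / th ^+ 2 - b2.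
  have kapth : kap * th ^+ 2 = s' - b2 * th ^+ 2.
    by rewrite mulrBl divfK// gt_eqF.
  exists kap, t'; split=> //.
    rewrite -(ler_pM2r th20) -{1}(gtr0_norm th20) -normrM kapth.
    by move: ss; rewrite subr0 add0r.
  by move=> x' xx'; apply: wx; rewrite xx' mulrDl kapth; ring.
(* moving against a nonzero gradient would lose the order of the square root of
   time, whereas dynamic programming only allows a loss of the order of time *)
have p0 : p = 0.
  apply/eqP; apply: contraT => pn0; have [f ff pE] := unit_vector pn0.
  have pn : 0 < enorm p by rewrite enorm_gt0.
  have nn : dotv (- f) (- f) = 1 by rewrite dotvNl dotvNr opprK.
  have [C C0 exp] := jet_expand0 n1 nn jet.
  have bQ : 0 <= b2 * `|quadv X (- f)| by rewrite mulr_ge0// ltW.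
  have C'0 : 0 < C + 1 + b2 * `|quadv X (- f)| by lra.
  have : 0 <= - (Num.sqrt (b2 / 2) * enorm p).
    apply: (second_order_sign (B := m - tau + b2 * `|quadv X (- f)|) C'0 _).1.
    move=> eps eps0 eps1.
    have meps : 0 < Num.min eps (b2 / 2) by rewrite lt_min eps0 divr_gt0.
    have [d d0 {}exp] := exp eps eps0 eps1.
    have [d' d'0 {}dpp'] := dpp' _ meps.
    exists (Num.min d d'); first by rewrite lt_min d0.
    move=> th th0; rewrite lt_min => /andP[thd thd'].
    have [kap [t' [tt kk wx]]] := dpp' th th0 thd'.
    have th20 : 0 < th ^+ 2 by rewrite exprn_gt0.
    have me : Num.min eps (b2 / 2) <= eps by rewrite ge_min lexx.
    have mb : Num.min eps (b2 / 2) <= b2 / 2 by rewrite ge_min lexx orbT.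
    have kb : `|kap| <= b2 / 2 by lra.
    have kb2 : `|kap| <= b2 by lra.
    have tt' : `|t' - (t0 - th ^+ 2)| <= eps * th ^+ 2.
      by apply: le_trans tt _; rewrite ler_wpM2r// ltW.
    have [x' xx' wx'] := exp th kap t' th0 thd kb2 tt'.
    have {}wx := wx x' xx'.
    have pf : dotv p (- f) = - enorm p by rewrite {1}pE dotvNr dotvZl ff mulr1.
    have F1 : th * (Num.sqrt (b2 / 2) * enorm p) <= th * (Num.sqrt (b2 + kap) * enorm p).
      rewrite ler_wpM2l ?(ltW th0)// ler_wpM2r ?enorm_ge0// ler_sqrt.
        by move: kb; rewrite ler_norml => /andP[]; lra.
      by move: kb; rewrite ler_norml => /andP[]; lra.
    have F2 : th ^+ 2 * ((b2 + kap) / 2 * quadv X (- f)) <= th ^+ 2 * (b2 * `|quadv X (- f)|).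
      rewrite ler_wpM2l ?(ltW th20)//; apply: le_trans (ler_norm _) _.
      rewrite normrM ler_wpM2r// ger0_norm; move: kb; rewrite ler_norml => /andP[]; lra.
    have F3 : th ^+ 2 * (m + Num.min eps (b2 / 2)) <= th ^+ 2 * (m + eps).
      by rewrite ler_wpM2l ?(ltW th20)// lerD2l.
    have F4 : 0 <= th ^+ 2 * (b2 * `|quadv X (- f)| * eps).
      by rewrite mulr_ge0 ?(ltW th20)// mulr_ge0 ?(ltW eps0)// mulr_ge0// ltW.
    move: wx' wx F1 F2 F3 F4; rewrite pf; clear; lra.
  rewrite oppr_ge0 leNgt mulr_gt0// sqrtr_gt0; lra.
rewrite p0 dotv0l enorm0; split=> // _.
have [C C0 exp] := jet_expand0 n1 ee jet.
have C'0 : 0 < C + 1 + `|quadv X e| by rewrite ltr_wpDr//; lra.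
apply: (second_order_sign (A := 0) C'0 _).2 => // eps eps0 eps1.
have meps : 0 < Num.min eps b2 by rewrite lt_min eps0.
have [d d0 {}exp] := exp eps eps0 eps1.
have [d' d'0 {}dpp'] := dpp' _ meps.
exists (Num.min d d'); first by rewrite lt_min d0.
move=> th th0; rewrite lt_min => /andP[thd thd'].
have [kap [t' [tt kk wx]]] := dpp' th th0 thd'.
have th20 : 0 < th ^+ 2 by rewrite exprn_gt0.
have me : Num.min eps b2 <= eps by rewrite ge_min lexx.
have mb : Num.min eps b2 <= b2 by rewrite ge_min lexx orbT.
have kb2 : `|kap| <= b2 by lra.
have tt' : `|t' - (t0 - th ^+ 2)| <= eps * th ^+ 2.
  by apply: le_trans tt _; rewrite ler_wpM2r// ltW.
have [x' xx' wx'] := exp th kap t' th0 thd kb2 tt'.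
have {}wx := wx x' xx'.
have F2 : th ^+ 2 * (kap * quadv X e) <= th ^+ 2 * (eps * `|quadv X e|).
  rewrite ler_wpM2l ?(ltW th20)//; apply: le_trans (ler_norm _) _.
  by rewrite normrM ler_wpM2r//; lra.
have F3 : th ^+ 2 * (m + Num.min eps b2) <= th ^+ 2 * (m + eps).
  by rewrite ler_wpM2l ?(ltW th20)// lerD2l.
have F4 : 0 <= th ^+ 2 * (eps * `|quadv X e|).
  by rewrite mulr_ge0 ?(ltW th20)// mulr_ge0// ltW.
have Eb2 : b2 = 2 * (n%:R - 1) by [].
move: wx' wx F2 F3 F4; rewrite p0 dotv0l; clear -Eb2; rewrite Eb2.
lra.
Qed.
End Jets.

(** * Touching radial functions from below *)

Section RadialTouching.
Variables (R : realType) (n : nat).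
Implicit Types (x y z p q e : 'rV[R]_n) (X Y : 'M[R]_n) (w : 'rV[R]_n * R -> R).

(** Counterpart of [superjet_radial] for functions touched from below. All radial
    speeds are now available, and moving along the gradient produces the full
    term [enorm p]. *)
Lemma subjet_radial w x0 t0 p X tau m : (1 < n)%N ->
  subjet w x0 t0 p X tau ->
  (forall eps, 0 < eps -> exists2 d, 0 < d & forall th kap, 0 < th -> th < d ->
    kap = 0 \/ `|kap| + eps <= 2 * enorm x0 ->
    forall x', dotv x' x' = dotv x0 x0 + (2 * (n%:R - 1) + kap) * th ^+ 2 ->
      w (x', t0 - th ^+ 2) + th ^+ 2 * (m - eps) <= w (x0, t0)) ->
  forall e, dotv e x0 = 0 ->
    dotv p e = 0 /\ (n%:R - 1) * quadv X e <= (tau - m - enorm p) * dotv e e.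
Proof.
move=> n1 jet dpp.
have b20 : 0 < 2 * (n%:R - 1) :> R by rewrite mulr_gt0// subr_gt0 ltr1n.
have b0 : 0 < Num.sqrt (2 * (n%:R - 1)) :> R by rewrite sqrtr_gt0.
have tte (eps th : R) : 0 < eps -> `|t0 - th ^+ 2 - (t0 - th ^+ 2)| <= eps * th ^+ 2.
  by move=> eps0; rewrite subrr normr0 mulr_ge0 ?sqr_ge0// ltW.
have first_order e : dotv e x0 = 0 -> dotv e e = 1 ->
    0 <= - dotv p e /\
    (- dotv p e = 0 -> 0 <= tau - m - (if x0 == 0 then 0 else `|dotv p x0| / enorm x0)
        - (n%:R - 1) * quadv X e).
  move=> ex ee; have [x00|x00] := eqVneq x0 0.
    rewrite x00 in jet dpp *.
    have [C C0 exp] := jet_expand0 n1 ee jet.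
    have C'0 : 0 < C + 1 by lra.
    have [A B] : 0 <= Num.sqrt (2 * (n%:R - 1)) * - dotv p e /\
       (Num.sqrt (2 * (n%:R - 1)) * - dotv p e = 0 ->
          0 <= tau - m - (n%:R - 1) * quadv X e).
      apply: (second_order_sign C'0) => eps eps0 eps1.
      have [d d0 {}exp] := exp eps eps0 eps1.
      have [d' d'0 {}dpp] := dpp eps eps0.
      exists (Num.min d d'); first by rewrite lt_min d0.
      move=> th th0; rewrite lt_min => /andP[thd thd'].
      have kb : `|0 : R| <= 2 * (n%:R - 1) by rewrite normr0 ltW.
      have [x' xx' wx'] := exp th 0 _ th0 thd kb (tte eps th eps0).
      have := dpp th 0 th0 thd' (or_introl erefl) x'.
      rewrite dotv0l add0r => /(_ xx').
      move: wx'; rewrite addr0 dotvNl quadvN; clear; lra.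
    split; first by rewrite pmulr_rge0 in A.
    by move=> pe; rewrite subr0; apply: B; rewrite pe mulr0.
  have r0 : 0 < enorm x0 by rewrite enorm_gt0.
  have s0 : 0 < dotv x0 x0 by rewrite dotvv_gt0.
  have K0 : 0 < 2 * enorm x0 by lra.
  have [C C0 exp] := jet_expand n1 x00 K0 ex ee jet.
  pose P := dotv p x0.
  have C'0 : 0 < C + 1 + `|P| / (2 * dotv x0 x0).
    have : 0 <= `|P| / (2 * dotv x0 x0) by rewrite divr_ge0//; lra.
    lra.
  have [A B] : 0 <= Num.sqrt (2 * (n%:R - 1)) * - dotv p e /\
     (Num.sqrt (2 * (n%:R - 1)) * - dotv p e = 0 ->
        0 <= tau - m - `|P| / enorm x0 - (n%:R - 1) * quadv X e).
    apply: (second_order_sign C'0) => eps eps0 eps1.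
    have meps : 0 < Num.min eps (enorm x0) by rewrite lt_min eps0.
    have me : Num.min eps (enorm x0) <= eps by rewrite ge_min lexx.
    have mb : Num.min eps (enorm x0) <= enorm x0 by rewrite ge_min lexx orbT.
    set eta := Num.min _ _ in meps me mb.
    have [d d0 {}exp] := exp eps eps0 eps1.
    have [d' d'0 {}dpp] := dpp _ meps.
    exists (Num.min d d'); first by rewrite lt_min d0.
    move=> th th0; rewrite lt_min => /andP[thd thd'].
    have th20 : 0 < th ^+ 2 by rewrite exprn_gt0.
    (* move radially in the direction of the gradient, at almost full speed *)
    pose kap : R := Num.sg P * (2 * enorm x0 - eta).
    have kn : `|kap| <= 2 * enorm x0 - eta.
      rewrite /kap normrM (@ger0_norm _ (_ - _)); last by lra.
      by rewrite ler_piMl ?normr_sg ?lern1 ?leq_b1//; lra.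
    have kb : `|kap| <= 2 * enorm x0 by lra.
    have kd : kap = 0 \/ `|kap| + eta <= 2 * enorm x0 by right; lra.
    have [x' xx' wx'] := exp th kap _ th0 thd kb (tte eps th eps0).
    have {}dpp := dpp th kap th0 thd' kd x' xx'.
    have kP : kap / (2 * dotv x0 x0) * dotv (- p) x0 <=
        - (`|P| / enorm x0) + `|P| / (2 * dotv x0 x0) * eps.
      have -> : kap / (2 * dotv x0 x0) * dotv (- p) x0 =
          - (`|P| / enorm x0) + `|P| / (2 * dotv x0 x0) * eta.
        rewrite /kap dotvNl -/P (normrEsg P) -enorm_sqr; field.
        exact: lt0r_neq0.
      by rewrite lerD2l ler_wpM2l// divr_ge0//; lra.
    have F1 : th ^+ 2 * (kap / (2 * dotv x0 x0) * dotv (- p) x0) <=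
        th ^+ 2 * (- (`|P| / enorm x0) + `|P| / (2 * dotv x0 x0) * eps).
      by rewrite ler_wpM2l// ltW.
    have F2 : th ^+ 2 * eta <= th ^+ 2 * eps by rewrite ler_wpM2l// ltW.
    move: wx' dpp F1 F2; rewrite (dotvNl p e) quadvN; clear; lra.
  split; first by rewrite pmulr_rge0 in A.
  by move=> pe; apply: B; rewrite pe mulr0.
have tang e : dotv e x0 = 0 -> dotv e e = 1 -> dotv p e = 0.
  move=> ex ee; have [A _] := first_order e ex ee.
  have [||B _] := first_order (- e).
  - by rewrite dotvNl ex oppr0.
  - by rewrite dotvNl dotvNr opprK.
  by move: A B; rewrite dotvNr; lra.
have orth e : dotv e x0 = 0 -> dotv p e = 0.
  move=> ex; have [->|e0] := eqVneq e 0; first by rewrite dotv0r.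
  have [e' e'1 eE] := unit_vector e0.
  rewrite eE dotvZr tang ?mulr0//.
  by move: ex; rewrite eE dotvZl => /eqP; rewrite mulf_eq0 enorm_eq0 (negbTE e0) => /eqP.
have pn : enorm p = if x0 == 0 then 0 else `|dotv p x0| / enorm x0.
  have [x00|x00] := eqVneq x0 0.
    by apply/eqP; rewrite enorm_eq0 -dotvv_eq0 orth// x00 dotv0r.
  have [c pc] := parallel_of_orth x00 orth.
  have en : enorm x0 != 0 by rewrite enorm_eq0.
  rewrite pc dotvZl enormZ normrM -enorm_sqr (ger0_norm (sqr_ge0 _)) expr2.
  by rewrite mulrA mulfK.
move=> e ex; split; first exact: orth.
have [->|e0] := eqVneq e 0; first by rewrite /quadv mul0mx !dotvE !mulr0.
have [e' e'1 eE] := unit_vector e0.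
have e'x : dotv e' x0 = 0.
  by move: ex; rewrite eE dotvZl => /eqP; rewrite mulf_eq0 enorm_eq0 (negbTE e0) => /eqP.
have [_] := first_order e' e'x e'1; rewrite (orth _ e'x) oppr0 -pn => /(_ erefl).
rewrite -(pmulr_rge0 _ (_ : 0 < enorm e ^+ 2)); last by rewrite exprn_gt0// enorm_gt0.
have -> : quadv X e = enorm e ^+ 2 * quadv X e' by rewrite {1}eE quadvZ.
by rewrite -enorm_sqr; lra.
Qed.

(** Averaging the inequalities for single directions over the directions
    orthogonal to the gradient recovers the operator. *)
Lemma superjet_H_le x0 p X (tau m : R) : (1 < n)%N -> X^T = X ->
  (forall e, dotv e x0 = 0 ->
    dotv p e = 0 /\ (tau - m - enorm p) * dotv e e <= (n%:R - 1) * quadv X e) ->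
  tau + H_lower p X <= m.
Proof.
move=> n1 sX H; have n0 : (0 < n)%N by exact: ltnW.
have [q pq qx] := tangential_dir n0 (fun e ex => (H e ex).1).
have := H_lower_le n0 sX pq.
have : tau - m - enorm p <= \tr (sigma_mx q *m X).
  by apply: trace_sigma_ge pq.1 n1 _ => e /qx /H[].
lra.
Qed.

Lemma subjet_H_ge x0 p X (tau m : R) : (1 < n)%N -> X^T = X ->
  (forall e, dotv e x0 = 0 ->
    dotv p e = 0 /\ (n%:R - 1) * quadv X e <= (tau - m - enorm p) * dotv e e) ->
  m <= tau + H_upper p X.
Proof.
move=> n1 sX H; have n0 : (0 < n)%N by exact: ltnW.
have [q pq qx] := tangential_dir n0 (fun e ex => (H e ex).1).
have := H_upper_ge n0 sX pq.
have : \tr (sigma_mx q *m X) <= tau - m - enorm p.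
  by apply: trace_sigma_le pq.1 n1 _ => e /qx /H[].
lra.
Qed.

(** Points of a given norm exist near [x0] as soon as that norm is close to the norm
    of [x0]; this lets semicontinuous envelopes of radial functions be computed
    along the radius. *)
Lemma radial_near x0 d : (0 < n)%N -> 0 < d -> exists2 d', 0 < d' &
  forall s, 0 <= s -> `|s - dotv x0 x0| < d' -> exists2 y, dotv y y = s & enorm (y - x0) < d.
Proof.
move=> n0 d0.
have [u uu [r [r0 xu]]] : exists2 u, dotv u u = 1 & exists r, 0 <= r /\ x0 = r *: u.
  have [x00|x00] := eqVneq x0 0.
    have [v /unit_vector[u uu _]] := nonzero_rV R n0.
    by exists u => //; exists 0; rewrite x00 scale0r.
  have [u uu xu] := unit_vector x00; exists u => //.
  by exists (enorm x0); rewrite enorm_ge0.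
exists (d ^+ 2); first by rewrite exprn_gt0.
move=> s s0; rewrite xu !dotvE uu !mulr1 => sr.
exists (Num.sqrt s *: u).
  by rewrite !dotvE uu !mulr1 -expr2 sqr_sqrtr.
rewrite -scalerBl enormZ /enorm uu sqrtr1 mulr1.
have q0 := sqrtr_ge0 s; have qs := sqr_sqrtr s0; set q := Num.sqrt s in q0 qs *.
rewrite -(@ltr_pXn2r _ 2) ?nnegrE//; last exact: ltW.
apply: le_lt_trans sr; rewrite -qs.
have -> : q ^+ 2 - r * r = (q - r) * (q + r) by ring.
rewrite normrM expr2 ler_wpM2l// (@ger0_norm _ (q + r)) ?addr_ge0//.
by rewrite ler_norml; lra.
Qed.
End RadialTouching.

(** * The radial control problem *)

Section Chains.
Variables (R : realType) (n : nat) (h : R -> R).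

(** Gains of piecewise linear paths of the squared radius [s]. The dynamics
    [r' = (n - 1) / r + a] with controls [-1 <= a <= 1] become
    [s' = 2 (n - 1) + 2 a sqrt s], whose drift is constant, so that the origin is
    an ordinary starting point. A linear path is admissible if it obeys the speed
    limit of its smallest radius. Each step earns a lower bound [m] for [h] along
    the path instead of an integral, which suits a discontinuous [h]. *)
Inductive reach : R -> R -> R -> Prop :=
| reach_stop s : 0 <= s -> reach s 0 0
| reach_step s s' d t m c : 0 <= s -> 0 <= s' -> 0 <= d ->
    `|s' - s - 2 * (n%:R - 1) * d| <= 2 * d * Num.sqrt (Num.min s s') ->
    (forall rho, Num.min s s' <= rho -> rho <= Num.max s s' -> m <= h (Num.sqrt rho)) ->
    reach s' t c -> reach s (d + t) (d * m + c).

Definition value (s t : R) : R := sup [set c | reach s t c].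

Hypothesis n1 : (1 < n)%N.
Hypothesis h_ge0 : forall r : R, 0 <= r -> 0 <= h r.
Variable M : R.
Hypothesis h_le : forall r : R, 0 <= r -> h r <= M.

Let b2 : R := 2 * (n%:R - 1).
Let b20 : 0 < b2.
Proof. by rewrite mulr_gt0// subr_gt0 ltr1n. Qed.

Lemma reach_dom s t c : reach s t c -> 0 <= s /\ 0 <= t.
Proof.
by elim=> {s t c} [s s0|s s' d t m c s0 s'0 d0 _ _ _ [_ t0]]; rewrite ?addr_ge0.
Qed.

Lemma reach_le s t c : reach s t c -> c <= t * M.
Proof.
elim=> {s t c} [s s0|s s' d t m c s0 s'0 d0 _ hm _ IH]; first by rewrite mul0r.
rewrite mulrDl lerD// ler_wpM2l//; apply: le_trans (h_le (sqrtr_ge0 s)).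
by apply: hm; rewrite ?ge_min ?le_max lexx.
Qed.

Lemma reach_coast s t : 0 <= s -> 0 <= t -> reach s t 0.
Proof.
move=> s0 t0; rewrite -[t]addr0 -[X in reach _ _ X](addr0 0) -[X in reach _ _ (X + _)](mulr0 t).
have st : 0 <= s + b2 * t by rewrite addr_ge0// mulr_ge0// ltW.
apply: (@reach_step _ (s + b2 * t)) => //; last exact: reach_stop.
  rewrite -/b2 (_ : _ - _ - _ = 0); last by ring.
  by rewrite normr0 !mulr_ge0// sqrtr_ge0.
by move=> rho _ _; apply: h_ge0; exact: sqrtr_ge0.
Qed.

Lemma reach_has_sup s t : 0 <= s -> 0 <= t -> has_sup [set c | reach s t c].
Proof.
move=> s0 t0; split; first by exists 0; exact: reach_coast.
by exists (t * M) => c /reach_le.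
Qed.

Lemma reach_value s t c : reach s t c -> c <= value s t.
Proof.
move=> r; have [s0 t0] := reach_dom r.
by apply: (sup_upper_bound (reach_has_sup s0 t0)).
Qed.

Lemma value_ge0 s t : 0 <= s -> 0 <= t -> 0 <= value s t.
Proof. by move=> s0 t0; apply: reach_value; exact: reach_coast. Qed.

Lemma value_le s t : 0 <= s -> 0 <= t -> value s t <= t * M.
Proof.
move=> s0 t0; apply: ge_sup; first by exists 0; exact: reach_coast.
by move=> c /reach_le.
Qed.

Lemma value_step s s' d t m : 0 <= s -> 0 <= s' -> 0 <= d -> 0 <= t ->
    `|s' - s - b2 * d| <= 2 * d * Num.sqrt (Num.min s s') ->
    (forall rho, Num.min s s' <= rho -> rho <= Num.max s s' -> m <= h (Num.sqrt rho)) ->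
  value s' t + d * m <= value s (d + t).
Proof.
move=> s0 s'0 d0 t0 sd hm; rewrite -lerBrDr; apply: ge_sup.
  by exists 0; exact: reach_coast.
move=> c r; rewrite lerBrDr addrC; apply: reach_value; exact: reach_step r.
Qed.

(** A chain can be interrupted at any time: a step is traversed at constant speed
    in [s], and both parts of a step are again admissible. *)
Lemma reach_cut s t c delta L m : reach s t c -> 0 <= L -> 0 <= delta -> delta <= t ->
  (forall rho, 0 <= rho -> `|rho - s| <= b2 * delta + 2 * delta * L ->
     h (Num.sqrt rho) <= m /\ Num.sqrt rho <= L) ->
  exists s' c', [/\ reach s' (t - delta) c', c <= c' + delta * m &
    `|s' - s - b2 * delta| <= 2 * delta * L].
Proof.
move=> r L0; elim: r delta => {s t c} [s s0|s s' d t m' c s0 s'0 d0 sd hm r IH] delta de0 det loc.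
  have {det} de : delta = 0 by lra.
  exists s, 0; rewrite de !(mulr0, mul0r, subr0, addr0, subrr) normr0.
  by split=> //; exact: reach_stop.
have sM : 0 <= Num.min s s' by rewrite le_min s0.
have locs : h (Num.sqrt s) <= m /\ Num.sqrt s <= L.
  apply: loc => //; rewrite subrr normr0.
  by apply: addr_ge0; apply: mulr_ge0 => //; [exact: ltW|exact: mulr_ge0].
have m'm : m' <= m.
  by apply: le_trans locs.1; apply: hm; rewrite ?ge_min ?le_max lexx.
have sq : Num.sqrt (Num.min s s') <= L.
  by apply: le_trans locs.2; rewrite ler_wsqrtr// ge_min lexx.
have [dd|dd] := leP delta d.
- have [d00|d00] := eqVneq d 0.
    have de : delta = 0 by lra.
    exists s, (d * m' + c); rewrite de !(mulr0, mul0r, subr0, addr0, subrr) normr0.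
    by split=> //; exact: reach_step r.
  have dp : 0 < d by rewrite lt_neqAle eq_sym d00.
  pose lam := delta / d.
  have lamd : lam * d = delta by rewrite /lam divfK.
  have lam0 : 0 <= lam by rewrite divr_ge0.
  have lam1 : lam <= 1 by rewrite /lam ler_pdivrMr// mul1r.
  pose s1 := s + lam * (s' - s).
  have [s1min s1max] : Num.min s s' <= s1 /\ s1 <= Num.max s s'.
    rewrite /s1; have [ss|ss] := leP s s'.
      have : 0 <= lam * (s' - s) by rewrite mulr_ge0// subr_ge0.
      have : 0 <= (1 - lam) * (s' - s) by rewrite mulr_ge0// subr_ge0.
      lra.
    have : 0 <= lam * (s - s') by rewrite mulr_ge0// subr_ge0 ltW.
    have : 0 <= (1 - lam) * (s - s') by rewrite mulr_ge0// subr_ge0// ltW.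
    lra.
  have s'min : Num.min s s' <= s' by rewrite ge_min lexx orbT.
  have s'max : s' <= Num.max s s' by rewrite le_max lexx orbT.
  have s10 : 0 <= s1 by exact: le_trans s1min.
  have dd0 : 0 <= d - delta by rewrite subr_ge0.
  exists s1, ((d - delta) * m' + c); split.
  + have -> : d + t - delta = (d - delta) + t by ring.
    apply: reach_step r => //.
      have -> : s' - s1 - 2 * (n%:R - 1) * (d - delta) =
          (1 - lam) * (s' - s - 2 * (n%:R - 1) * d) by rewrite /s1 -lamd; ring.
      rewrite normrM ger0_norm ?subr_ge0//.
      apply: le_trans (ler_wpM2l _ sd) _; first by rewrite subr_ge0.
      have -> : (1 - lam) * (2 * d * Num.sqrt (Num.min s s')) =
          2 * (d - delta) * Num.sqrt (Num.min s s') by rewrite -lamd; ring.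
      by rewrite ler_wpM2l ?mulr_ge0// ler_wsqrtr// le_min s1min.
    move=> rho r1 r2; apply: hm.
      by apply: le_trans r1; rewrite le_min s1min.
    by apply: le_trans r2 _; rewrite ge_max s1max.
  + have : delta * m' <= delta * m by rewrite ler_wpM2l.
    lra.
  + have -> : s1 - s - b2 * delta = lam * (s' - s - b2 * d) by rewrite /s1 -lamd; ring.
    rewrite normrM ger0_norm//; apply: le_trans (ler_wpM2l lam0 sd) _.
    have -> : lam * (2 * d * Num.sqrt (Num.min s s')) =
        2 * delta * Num.sqrt (Num.min s s') by rewrite -lamd; ring.
    by rewrite ler_wpM2l// mulr_ge0.
- have [|||s1 [c1 [r1 cc1 ss1]]] := IH (delta - d).
  + by lra.
  + by lra.
  + move=> rho rho0 rs; apply: loc => //.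
    have -> : rho - s = (rho - s') + (s' - s - b2 * d) + b2 * d by ring.
    apply: le_trans (ler_normD _ _) _; rewrite (@ger0_norm _ (b2 * d)); last first.
      by rewrite mulr_ge0// ltW.
    apply: le_trans (lerD (ler_normD _ _) (lexx _)) _.
    have : 2 * d * Num.sqrt (Num.min s s') <= 2 * d * L by rewrite ler_wpM2l// mulr_ge0.
    by move: rs sd; rewrite -/b2; lra.
  exists s1, c1; split.
  + by have -> : d + t - delta = t - (delta - d) by ring.
  + have : d * m' <= d * m by rewrite ler_wpM2l.
    lra.
  + have -> : s1 - s - b2 * delta = (s1 - s' - b2 * (delta - d)) + (s' - s - b2 * d) by ring.
    apply: le_trans (ler_normD _ _) _.
    have : 2 * d * Num.sqrt (Num.min s s') <= 2 * d * L by rewrite ler_wpM2l// mulr_ge0.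
    by move: ss1 sd; rewrite -/b2; lra.
Qed.

Lemma value_cut s t delta L m eps : 0 <= L -> 0 <= s -> 0 <= delta -> delta <= t -> 0 < eps ->
  (forall rho, 0 <= rho -> `|rho - s| <= b2 * delta + 2 * delta * L ->
     h (Num.sqrt rho) <= m /\ Num.sqrt rho <= L) ->
  exists s', [/\ 0 <= s', `|s' - s - b2 * delta| <= 2 * delta * L &
    value s t <= value s' (t - delta) + delta * m + eps].
Proof.
move=> L0 s0 de0 det eps0 loc; have t0 : 0 <= t by exact: le_trans det.
have [c r cv] := sup_adherent eps0 (reach_has_sup s0 t0).
have [s' [c' [r' cc' ss']]] := reach_cut r L0 de0 det loc.
exists s'; split=> //; first by have [] := reach_dom r'.
have := reach_value r'; rewrite -/(value s t) in cv; lra.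
Qed.

(** The radius decreases at most at unit speed, so a path starting far away never
    meets the support of [h]. *)
Lemma reach_far R0 s t c : (forall r, R0 < r -> h r = 0) ->
  reach s t c -> R0 + t < Num.sqrt s -> c <= 0.
Proof.
move=> h0; elim=> {s t c} [//|s s' d t m c s0 s'0 d0 sd hm r IH] sR.
have [_ t0] := reach_dom r.
have m0 : m <= 0.
  rewrite -(h0 (Num.sqrt s)); last by lra.
  by apply: hm; rewrite ?ge_min ?le_max lexx.
have c0 : c <= 0.
  apply: IH.
  have : Num.sqrt s <= Num.sqrt s' + d; last by lra.
  have q0 := sqrtr_ge0 s'; have qs := sqr_sqrtr s'0.
  rewrite -(@ler_pXn2r _ 2) ?nnegrE ?sqrtr_ge0 ?addr_ge0// sqr_sqrtr// sqrrD qs.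
  have : 2 * d * Num.sqrt (Num.min s s') <= 2 * d * Num.sqrt s'.
    by rewrite ler_wpM2l ?mulr_ge0// ler_wsqrtr// ge_min lexx orbT.
  have : 0 <= b2 * d by rewrite mulr_ge0// ltW.
  have : 0 <= d ^+ 2 by rewrite sqr_ge0.
  move: sd; rewrite -/b2 ler_norml => /andP[]; lra.
have : d * m <= 0 by rewrite mulr_ge0_le0.
lra.
Qed.

Lemma value_far R0 s t : (forall r, R0 < r -> h r = 0) -> 0 <= s -> 0 <= t ->
  R0 + t < Num.sqrt s -> value s t = 0.
Proof.
move=> h0 s0 t0 sR; apply/eqP; rewrite eq_le value_ge0// andbT.
apply: ge_sup; first by exists 0; exact: reach_coast.
by move=> c r; exact: reach_far h0 r sR.
Qed.
End Chains.

(** * The value function as a viscosity solution *)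

Section ValueSolution.
Variables (R : realType) (n : nat) (h : R -> R) (M : R).
Hypothesis n1 : (1 < n)%N.
Hypothesis h_ge0 : forall r : R, 0 <= r -> 0 <= h r.
Hypothesis h_le : forall r : R, 0 <= r -> h r <= M.
Hypothesis h_usc : upper_semicontinuous_on [set r : R | 0 <= r] h.
Implicit Types (x y : 'rV[R]_n) (t s : R).

Let n0 : (0 < n)%N. Proof. exact: ltnW. Qed.
Let b2 : R := 2 * (n%:R - 1).
Let b20 : 0 < b2.
Proof. by rewrite mulr_gt0// subr_gt0 ltr1n. Qed.

Definition radial_value (z : 'rV[R]_n * R) : R := value n h (dotv z.1 z.1) z.2.
Let v := radial_value.
Let f x := h (enorm x).
Let ST := @spacetime R n.

Let M0 : 0 <= M.
Proof. by apply: le_trans (h_le (lexx 0)); exact: h_ge0. Qed.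

Lemma radial_value_ge0 z : ST z -> 0 <= v z.
Proof. by move=> z0; apply: (value_ge0 n1 h_ge0 h_le) => //; exact: dotvv_ge0. Qed.

Lemma radial_value_le z : ST z -> v z <= z.2 * M.
Proof. by move=> z0; apply: (value_le n1 h_ge0 h_le) => //; exact: dotvv_ge0. Qed.

Lemma radial_value_bounded (z : 'rV[R]_n * R) : bounded_near v (within ST (nbhs z)).
Proof.
case: z => x t; apply: (@bounded_near_le _ _ _ _ ((`|t| + 1) * M)).
apply/nbhs_rVRP; exists 1 => // y s _ st ST0.
rewrite ger0_norm ?radial_value_ge0//; apply: le_trans (radial_value_le ST0) _.
rewrite ler_wpM2r//=; have := ler_norm (s - t); have := ler_norm t; lra.
Qed.

Lemma dotvv_near x e : 0 < e -> exists2 d, 0 < d &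
  forall y, enorm (y - x) < d -> `|dotv y y - dotv x x| < e.
Proof.
move=> e0; have x0 := enorm_ge0 x.
have D0 : 0 < 2 * enorm x + 1 by lra.
exists (Num.min 1 (e / (2 * enorm x + 1))); first by rewrite lt_min ltr01 divr_gt0.
move=> y; rewrite lt_min ltr_pdivlMr// => /andP[y1 ye].
have -> : dotv y y - dotv x x = dotv (y - x) (y - x) + 2 * dotv (y - x) x.
  by rewrite !dotvE (dotvC x y); ring.
apply: le_lt_trans (ler_normD _ _) _; rewrite normrM (ger0_norm (dotvv_ge0 _)).
rewrite -enorm_sqr (@ger0_norm _ 2)//.
have := cauchy_schwarz (y - x) x.
have : enorm (y - x) ^+ 2 <= enorm (y - x) by rewrite expr2 ler_piMr ?enorm_ge0// ltW.
lra.
Qed.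

Lemma rhs_usc x e : 0 < e -> exists2 d, 0 < d & forall rho, 0 <= rho ->
  `|rho - dotv x x| < d -> h (Num.sqrt rho) <= f x + e /\ Num.sqrt rho <= enorm x + e.
Proof.
move=> e0.
have : h (enorm x) < h (enorm x) + e by rewrite ltrDl.
move=> /(h_usc (enorm_ge0 x))/nbhs_ballP[d /= d0 hd].
pose d1 := Num.min d e.
have d10 : 0 < d1 by rewrite lt_min d0.
exists (d1 ^+ 2); first by rewrite exprn_gt0.
move=> rho rho0 rx.
have q0 := sqrtr_ge0 rho; have qs := sqr_sqrtr rho0; have r0 := enorm_ge0 x.
set q := Num.sqrt rho in q0 qs *.
have qx : `|q - enorm x| < d1.
  rewrite -(@ltr_pXn2r _ 2) ?nnegrE//; last exact: ltW.
  apply: le_lt_trans rx; rewrite -qs -enorm_sqr.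
  have -> : q ^+ 2 - enorm x ^+ 2 = (q - enorm x) * (q + enorm x) by ring.
  rewrite normrM expr2 ler_wpM2l// (@ger0_norm _ (q + enorm x)) ?addr_ge0//.
  by rewrite ler_norml; lra.
move: qx; rewrite lt_min => /andP[qd qe]; split.
  by apply/ltW/hd => //=; rewrite /ball/= distrC.
by move: qe; rewrite ltr_norml; lra.
Qed.

Lemma rhs_bounded x : bounded_near f (within setT (nbhs x)).
Proof.
apply: (@bounded_near_le _ _ _ _ M).
apply/nbhs_rVP; exists 1 => // y _ _.
by rewrite ger0_norm ?h_ge0 ?h_le ?enorm_ge0.
Qed.

(** The envelope is taken in space; points of every nearby radius exist, so its
    lower bound holds along the radius as well. *)
Lemma rhs_lsc x a : a < lower_env setT f x -> exists2 d, 0 < d & forall rho, 0 <= rho ->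
  `|rho - dotv x x| < d -> a <= h (Num.sqrt rho).
Proof.
have FF : ProperFilter (within setT (nbhs x)) by exact: within_proper.
move=> /(lower_env_gt FF (rhs_bounded x))/nbhs_rVP[d d0 fd].
have [d' d'0 rad] := radial_near x n0 d0; exists d' => // rho rho0 /(rad _ rho0)[y <- yx].
by apply/ltW; exact: (fd y yx).
Qed.

Let U := upper_env ST v.
Let L := lower_env ST v.

Let STproper x t : 0 <= t -> ProperFilter (within ST (nbhs (x, t))).
Proof. by move=> t0; apply: within_proper. Qed.

(** Choose a point close to [(x0, t0)] where the value almost attains its envelope,
    and cut an almost optimal chain from there at time [th ^+ 2]: up to that time
    it stays where the source exceeds [f x0] by little. *)
Lemma upper_value_dpp x0 t0 : 0 < t0 ->
  forall eps, 0 < eps -> exists2 d, 0 < d & forall th, 0 < th -> th < d ->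
    exists s' t', [/\ `|t' - (t0 - th ^+ 2)| <= eps * th ^+ 2,
      `|s' - dotv x0 x0 - b2 * th ^+ 2| <= (2 * enorm x0 + eps) * th ^+ 2 &
      forall x', dotv x' x' = s' -> U (x0, t0) <= U (x', t') + th ^+ 2 * (f x0 + eps)].
Proof.
move=> t00 eps eps0; have x00 := enorm_ge0 x0.
have e4 : 0 < eps / 4 by lra.
have [d1 d10 loc] := rhs_usc x0 e4.
pose l := enorm x0 + eps / 4.
have l0 : 0 < l by rewrite /l; lra.
pose D := b2 + 2 * l.
have D0 : 0 < D by apply: addr_gt0 => //; exact: mulr_gt0.
exists (Num.min 1 (Num.min (t0 / 2) (d1 / 2 / D))).
  by rewrite !lt_min ltr01 !divr_gt0.
move=> th th0; rewrite !lt_min => /and3P[th1 tht thd].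
pose de := th ^+ 2.
have de0 : 0 < de by rewrite exprn_gt0.
have deth : de <= th by rewrite /de expr2 ler_piMr// ltW.
have Dde : D * de < d1 / 2.
  move: thd; rewrite ltr_pdivlMr// mulrC; apply: le_lt_trans.
  by rewrite ler_wpM2l// ltW.
have eta0 : 0 < Num.min (d1 / 2) (eps * de / 2) by rewrite lt_min !divr_gt0// mulr_gt0.
have [d2 d20 near2] := dotvv_near x0 eta0.
have A : nbhs (x0, t0) [set z | `|dotv z.1 z.1 - dotv x0 x0| < Num.min (d1 / 2) (eps * de / 2) /\
    `|z.2 - t0| < Num.min (t0 / 2) (eps * de)].
  apply/nbhs_rVRP; exists (Num.min d2 (Num.min (t0 / 2) (eps * de))).
    by rewrite !lt_min d20 divr_gt0// mulr_gt0.
  move=> y s; rewrite lt_min => /andP[yd _]; rewrite lt_min => /andP[_ st].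
  by split=> //=; exact: near2.
have Ult : U (x0, t0) - eps / 4 * de < U (x0, t0) by rewrite gtrDl oppr_lt0 mulr_gt0.
have [[x t] [/= ST0 [/= xs ts] vU]] :=
  upper_env_freq (STproper x0 (ltW t00)) (radial_value_bounded _) Ult A.
move: xs ts; rewrite !lt_min => /andP[xs1 xs2] /andP[ts1 ts2].
have det : de <= t by move: ts1; rewrite ltr_norml => /andP[]; lra.
have edel : 0 < eps / 4 * de by rewrite mulr_gt0.
have [|s' [s'0 ss' vs']] := value_cut n1 h_ge0 h_le (ltW l0) (dotvv_ge0 x) (ltW de0) det edel
   (m := f x0 + eps / 4).
  move=> rho rho0 rs; apply: loc => //.
  have -> : rho - dotv x0 x0 = (rho - dotv x x) + (dotv x x - dotv x0 x0) by ring.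
  apply: le_lt_trans (ler_normD _ _) _.
  by move: rs Dde; rewrite /D -/b2; lra.
exists s', (t - de); split.
- have -> : t - de - (t0 - th ^+ 2) = t - t0 by rewrite /de; ring.
  exact: ltW.
- have -> : s' - dotv x0 x0 - b2 * th ^+ 2 = (s' - dotv x x - b2 * de) + (dotv x x - dotv x0 x0).
    by rewrite /de; ring.
  apply: le_trans (ler_normD _ _) _; rewrite -/de.
  by move: ss'; rewrite /l -/b2; lra.
- move=> x' xs'; have ST' : ST (x', t - de) by rewrite /ST/spacetime/= subr_ge0.
  have vs1 : value n h s' (t - de) <= U (x', t - de).
    by rewrite -xs'; exact: (upper_env_ge ST' (radial_value_bounded _)).
  have vx : U (x0, t0) - eps / 4 * de < value n h (dotv x x) t by [].
  rewrite -/de; move: vx vs' vs1 edel.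
  move: (U (x0, t0)) (U (x', t - de)) (f x0) => U0 U1 f0.
  move: (value n h (dotv x x) t) (value n h s' (t - de)) => V0 V1.
  by lra.
Qed.

(** The speed limit at radius [r] is [r] itself, up to a factor, hence continuous:
    the margin [eps] at [r0] absorbs small changes of the radius. *)
Lemma admissible_near (r0 eps : R) : 0 <= r0 -> 0 < eps -> exists2 d, 0 < d &
  forall kap s s' : R, `|kap| + eps <= 2 * r0 -> `|s - r0 ^+ 2| < d -> `|s' - r0 ^+ 2| < d ->
    0 <= s' /\ `|kap| <= 2 * Num.sqrt (Num.min s s').
Proof.
move=> r00 eps0; have [er|er] := leP eps (2 * r0); last first.
  by exists 1 => // kap s s' kr; have := normr_ge0 kap; lra.
have ee : eps * eps <= eps * (2 * r0) by rewrite ler_wpM2l// ltW.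
have e2 : 0 < eps * eps by rewrite mulr_gt0.
exists (r0 * eps - eps ^+ 2 / 4) => [|kap s s' kr]; first by lra.
have q0 : 0 <= r0 - eps / 2 by lra.
rewrite !ltr_norml => /andP[s1 _] /andP[s'1 _].
have sq : (r0 - eps / 2) ^+ 2 = r0 ^+ 2 - r0 * eps + eps ^+ 2 / 4 by field.
have qs : (r0 - eps / 2) ^+ 2 <= s by rewrite sq; lra.
have qs' : (r0 - eps / 2) ^+ 2 <= s' by rewrite sq; lra.
split; first by apply: le_trans qs'; exact: sqr_ge0.
have : r0 - eps / 2 <= Num.sqrt (Num.min s s').
  by rewrite -(ger0_norm q0) -sqrtr_sqr ler_wsqrtr// le_min qs.
lra.
Qed.

Lemma between_near (a s s' d rho : R) : `|s - a| < d -> `|s' - a| < d ->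
  Num.min s s' <= rho -> rho <= Num.max s s' -> `|rho - a| < d.
Proof.
rewrite !ltr_distl ge_min le_max => /andP[s1 s2] /andP[s'1 s'2] m1 m2.
apply/andP; split.
  by case/orP: m1; apply: lt_le_trans.
by case/orP: m2 => /le_lt_trans; apply.
Qed.

(** From every point close to [(x0, t0)] one admissible step leads close to the
    sphere through [x'], so the bound passes to the envelope. *)
Lemma lower_value_dpp x0 t0 : 0 < t0 ->
  forall eps, 0 < eps -> exists2 d, 0 < d & forall th kap, 0 < th -> th < d ->
    kap = 0 \/ `|kap| + eps <= 2 * enorm x0 ->
    forall x', dotv x' x' = dotv x0 x0 + (b2 + kap) * th ^+ 2 ->
      L (x', t0 - th ^+ 2) + th ^+ 2 * (lower_env setT f x0 - eps) <= L (x0, t0).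
Proof.
move=> t00 eps eps0; have x00 := enorm_ge0 x0.
have flt : lower_env setT f x0 - eps < lower_env setT f x0 by rewrite gtrDl oppr_lt0.
have [d1 d10 loc] := rhs_lsc flt.
have [r1 r10 adm] := admissible_near x00 eps0.
pose D := b2 + 2 * enorm x0.
have D0 : 0 < D by apply: ltr_wpDr => //; exact: mulr_ge0.
pose d2 := Num.min d1 r1.
have d20 : 0 < d2 by rewrite lt_min d10.
have d22 : 0 < d2 / 2 by rewrite divr_gt0.
exists (Num.min 1 (Num.min (t0 / 2) (d2 / 2 / D))).
  by rewrite !lt_min ltr01 !divr_gt0.
move=> th kap th0; rewrite !lt_min => /and3P[th1 tht thd] kd x' xx'.
pose de := th ^+ 2.
have de0 : 0 < de by rewrite exprn_gt0.
have deth : de <= th by rewrite /de expr2 ler_piMr// ltW.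
have det0 : de < t0 / 2 by exact: le_lt_trans tht.
have Dde : D * de < d2 / 2.
  move: thd; rewrite ltr_pdivlMr// mulrC; apply: le_lt_trans.
  by rewrite ler_wpM2l// ltW.
have kle : `|kap| <= 2 * enorm x0.
  case: kd => [->|]; first by rewrite normr0 mulr_ge0.
  by apply: le_trans; rewrite lerDl ltW.
have kD : `|b2 + kap| <= D.
  by apply: le_trans (ler_normD _ _) _; rewrite (gtr0_norm b20) /D lerD2l.
have t1 : 0 <= t0 - de by move: det0 t00; lra.
apply/ler_addgt0Pr => eta eta0; rewrite -lerBlDr.
apply: lower_env_ge; first exact: STproper (ltW t00).
  exact: radial_value_bounded.
have Llt : L (x', t0 - de) - eta < L (x', t0 - de) by rewrite gtrDl oppr_lt0.
have := lower_env_gt (STproper x' t1) (radial_value_bounded _) Llt.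
move=> /nbhs_rVRP[d3 d30 near3].
have [d4 d40 rad4] := radial_near x' n0 d30.
have mu0 : 0 < Num.min (d2 / 2) d4 by rewrite lt_min d22.
have [d5 d50 near5] := dotvv_near x0 mu0.
apply/nbhs_rVRP; exists (Num.min d5 (Num.min d3 (t0 / 2))).
  by rewrite !lt_min d50 d30 divr_gt0.
move=> x t; rewrite lt_min => /andP[xd _]; rewrite !lt_min => /and3P[_ td3 td0] ST0.
have := near5 x xd; rewrite lt_min => /andP[xs2 xs4].
pose s' := dotv x x + (b2 + kap) * de.
have det : de <= t.
  move: td0; rewrite ltr_distl => /andP[+ _]; have -> : t0 - t0 / 2 = t0 / 2 by field.
  by move=> /(lt_trans det0)/ltW.
have s's : `|s' - dotv x x| < d2 / 2.
  rewrite /s' addrC addKr normrM (gtr0_norm de0); apply: le_lt_trans Dde.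
  by rewrite ler_wpM2r// ltW.
have xx0 : `|dotv x x - dotv x0 x0| < d2.
  by apply: lt_trans xs2 _; rewrite gtr_pMr// invf_lt1// ltr1n.
have s'x0 : `|s' - dotv x0 x0| < d2.
  have -> : s' - dotv x0 x0 = (s' - dotv x x) + (dotv x x - dotv x0 x0) by ring.
  by apply: le_lt_trans (ler_normD _ _) _; rewrite (splitr d2) ltrD.
have [[xd1 xr1] [s'd1 s'r1]] : (`|dotv x x - dotv x0 x0| < d1 /\ `|dotv x x - dotv x0 x0| < r1) /\
    (`|s' - dotv x0 x0| < d1 /\ `|s' - dotv x0 x0| < r1).
  by move: xx0 s'x0; rewrite !lt_min => /andP[? ?] /andP[? ?].
rewrite -(enorm_sqr x0) in xr1 s'r1.
have [s'0 kmin] : 0 <= s' /\ `|kap| <= 2 * Num.sqrt (Num.min (dotv x x) s').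
  case: kd => [k0|kr]; last exact: (adm _ _ _ kr xr1 s'r1).
  rewrite /s' k0 addr0 normr0 mulr_ge0 ?sqrtr_ge0//; split=> //.
  by rewrite addr_ge0 ?dotvv_ge0// mulr_ge0// ltW.
have [|y ys yx] := rad4 s' s'0.
  rewrite xx' /s' -/de.
  by have -> : dotv x x + (b2 + kap) * de - (dotv x0 x0 + (b2 + kap) * de)
    = dotv x x - dotv x0 x0 by ring.
have Vy : L (x', t0 - de) - eta < v (y, t - de).
  apply: (near3 y (t - de) yx).
    by have -> : t - de - (t0 - de) = t - t0 by ring.
  by rewrite /ST/spacetime/= subr_ge0.
have := @value_step _ n h n1 h_ge0 M h_le (dotv x x) s' de (t - de)
  (lower_env setT f x0 - eps) (dotvv_ge0 x) s'0 (ltW de0).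
rewrite subr_ge0 (addrC de) subrK => /(_ det) step.
have xy : v (y, t - de) + de * (lower_env setT f x0 - eps) <= v (x, t).
  rewrite /v /radial_value/= ys; apply: step.
    have -> : s' - dotv x x - 2 * (n%:R - 1) * de = kap * de by rewrite /s' /b2; ring.
    by rewrite normrM (gtr0_norm de0) mulrAC ler_wpM2r// ltW.
  move=> rho rho1 rho2; apply: loc; last exact: between_near rho1 rho2.
  by apply: le_trans rho1; rewrite le_min dotvv_ge0.
apply: le_trans xy; rewrite -/de addrAC lerD2r ltW//.
Qed.

(** Dynamic programming for the two envelopes provides exactly the inequalities
    which the touching lemmas turn into inequalities for jets. *)
Lemma value_viscosity : viscosity_solution f (fun=> 0) v.
Proof.
split; split.
- by move=> z _; exact: radial_value_bounded.
- move=> x; have FF := STproper x (lexx 0); apply/ler_addgt0Pr => e e0; rewrite add0r.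
  apply: upper_env_le => //; first exact: radial_value_bounded.
  apply/nbhs_rVRP; exists (e / (M + 1)); first by rewrite divr_gt0// ltr_wpDl.
  move=> y s _; rewrite subr0 ltr_pdivlMr ?ltr_wpDl// => se S0.
  apply: le_trans (radial_value_le S0) _ => /=.
  move: se; rewrite ger0_norm//; move: (S0); rewrite /ST/spacetime/=; lra.
- move=> x0 t0 p X tau t00 jet; apply: (@le_trans _ _ (f x0)); last first.
    by apply: upper_env_ge => //; exact: rhs_bounded.
  apply: superjet_H_le n1 jet.1 _.
  exact: superjet_radial n1 jet (upper_value_dpp x0 t00).
- by move=> z _; exact: radial_value_bounded.
- move=> x; have FF := STproper x (lexx 0).
  apply: lower_env_ge => //; first exact: radial_value_bounded.
  by apply/nbhs_rVRP; exists 1 => // y s _ _; exact: radial_value_ge0.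
- move=> x0 t0 p X tau t00 jet.
  have sX : X^T = X by have := jet.1; rewrite linearN/= => /oppr_inj.
  apply: subjet_H_ge n1 sX _.
  exact: subjet_radial n1 jet (lower_value_dpp x0 t00).
Qed.

Lemma value_compact_support (R0 : R) : 0 < R0 -> (forall r, R0 < r -> h r = 0) ->
  compactly_supported_in_space v.
Proof.
move=> R00 h0 T T0; exists (R0 + T + 1); first by lra.
move=> x t /negP; rewrite -leNgt => xR /andP[t0 tT].
apply: (value_far n1 h_ge0 h_le h0) => //=; first exact: dotvv_ge0.
by rewrite -/(enorm x); lra.
Qed.
End ValueSolution.

(** * Comparison with radial barriers *)

Section Comparison.
Variables (R : realType) (n : nat).
Hypothesis n1 : (1 < n)%N.
Implicit Types (x y p : 'rV[R]_n).

Let n0 : (0 < n)%N. Proof. exact: ltnW. Qed.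
Let ST := @spacetime R n.

Lemma posD_le (y e : R) :
  Num.max (y + e) 0 ^+ 2 <= Num.max y 0 ^+ 2 + 2 * Num.max y 0 * e + e ^+ 2.
Proof.
have [y0|y0] := leP y 0; have [ye|ye] := leP (y + e) 0.
- by rewrite expr0n/= mulr0 mul0r !add0r sqr_ge0.
- rewrite expr0n/= mulr0 mul0r !add0r ler_pXn2r// ?nnegrE; lra.
- have -> : y ^+ 2 + 2 * y * e + e ^+ 2 = (y + e) ^+ 2 by ring.
  by rewrite expr0n/= sqr_ge0.
- have -> : y ^+ 2 + 2 * y * e + e ^+ 2 = (y + e) ^+ 2 by ring.
  exact: lexx.
Qed.

Lemma posD_ge (y e : R) :
  Num.max y 0 ^+ 2 + 2 * Num.max y 0 * e <= Num.max (y + e) 0 ^+ 2.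
Proof.
have [y0|y0] := leP y 0; have [ye|ye] := leP (y + e) 0.
- by rewrite expr0n/= mulr0 mul0r addr0.
- by rewrite expr0n/= mulr0 mul0r addr0 sqr_ge0.
- rewrite expr0n/=; have : y * (y + e) <= 0 by rewrite mulr_ge0_le0// ltW.
  have e0 : e <= 0 by lra.
  have : y * e <= 0 by rewrite mulr_ge0_le0// ltW.
  lra.
- have -> : (y + e) ^+ 2 = y ^+ 2 + 2 * y * e + e ^+ 2 by ring.
  by rewrite lerDl sqr_ge0.
Qed.

Lemma annulus_compact (a r : R) :
  compact [set x : 'rV[R]_n | a <= dotv x x /\ dotv x x <= r ^+ 2].
Proof.
have r0 : 0 <= `|r| by [].
have box := rV_compact (fun _ : 'I_n => @segment_compact R (- `|r|) `|r|).
have dc : continuous (fun x : 'rV[R]_n => dotv x x).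
  by move=> x; rewrite /continuous_at -quadv1; under eq_cvg do rewrite -quadv1; exact: quadv_cvg.
apply: (subclosed_compact _ box).
- have -> : [set x : 'rV[R]_n | a <= dotv x x /\ dotv x x <= r ^+ 2] =
     (fun x : 'rV[R]_n => dotv x x) @^-1` `[a, r ^+ 2].
    by apply/seteqP; split=> x /=; rewrite in_itv/= => /andP.
  by apply: preimage_closed => [x _|]; [exact: dc|exact: interval_closed].
- move=> x [_ xr] i; rewrite /= in_itv/= -ler_norml.
  apply: le_trans (coord_le_enorm x i) _.
  by rewrite -(@ler_pXn2r _ 2) ?nnegrE ?enorm_ge0// enorm_sqr real_normK ?num_real.
Qed.

Lemma penalty_lsc x0 (t1 t0 k N : R) (g : R -> R) (e : R) :
  g r @[r --> dotv x0 x0] --> g (dotv x0 x0) -> 0 <= k -> 0 <= N -> 0 < e ->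
  exists2 d, 0 < d & forall x t, enorm (x - x0) < d -> `|t - t0| < d ->
    k * t0 + g (dotv x0 x0) + N * Num.max (t0 - t1) 0 ^+ 2 - e <
    k * t + g (dotv x x) + N * Num.max (t - t1) 0 ^+ 2.
Proof.
move=> gc k0 N0 e0.
have e20 : 0 < e / 2 by rewrite divr_gt0.
have /cvgrPdist_lt/(_ _ e20)/nbhs_ballP[d2 /= d20 near2] := gc.
have [d3 d30 near3] := dotvv_near x0 d20.
have P00 : 0 <= Num.max (t0 - t1) 0 by rewrite le_max lexx orbT.
have Q0 : 0 <= k + 2 * N * Num.max (t0 - t1) 0 by rewrite addr_ge0// !mulr_ge0.
have Q1 : 0 < k + 2 * N * Num.max (t0 - t1) 0 + 1 by rewrite ltr_wpDl.
exists (Num.min d3 (e / 2 / (k + 2 * N * Num.max (t0 - t1) 0 + 1))).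
  by rewrite !lt_min d30 !divr_gt0.
move=> x t; rewrite !lt_min => /andP[xd3 _] /andP[_ te].
have ge : g (dotv x0 x0) - e / 2 < g (dotv x x).
  have : `|g (dotv x0 x0) - g (dotv x x)| < e / 2.
    by apply: near2; rewrite /ball/= distrC; exact: near3.
  by rewrite ltr_norml ltrBlDr ltrBlDl => /andP[_].
have te' : - (e / 2) <= (k + 2 * N * Num.max (t0 - t1) 0) * (t - t0).
  rewrite lerNl -mulrN; apply: le_trans (ler_norm _) _; rewrite normrM normrN ger0_norm//.
  move: te; rewrite ltr_pdivlMr// => /ltW; apply: le_trans.
  by rewrite mulrDr mulr1 mulrC lerDl.
have := posD_ge (t0 - t1) (t - t0).
have -> : t0 - t1 + (t - t0) = t - t1 by ring.
move=> /(ler_wpM2l N0); move: te' ge.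
move: (Num.max (t0 - t1) 0) (Num.max (t - t1) 0) (g _) (g _) => P0 P1 g3 g4; lra.
Qed.

(** The gradient of a radial function is radial, so the projection orthogonal to it
    removes the radial second derivative [c]. Where the gradient vanishes because
    of [g1], nothing would remove [c], and it has to vanish too. *)
Lemma H_lower_radial x (g1 c : R) : g1 <= 0 -> (g1 = 0 -> c = 0) ->
  - (2 * g1 * (n%:R - 1 - enorm x)) <=
    H_lower ((2 * g1) *: x) ((2 * g1)%:M + (16 * c) *: (x^T *m x)).
Proof.
move=> g10 gc; set p := _ *: x; set X := (_%:M + _).
have sX : X^T = X.
  by rewrite /X linearD/= linearZ/= tr_scalar_mx trmx_mul trmxK.
have [p0|p0] := eqVneq p 0.
  have -> : X = (2 * g1)%:M.
    move/eqP : p0; rewrite /p scaler_eq0 mulf_eq0 pnatr_eq0/= => /orP[/eqP g0|/eqP x0].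
      by rewrite /X gc// mulr0 scale0r addr0.
    by rewrite /X x0 mulmx0 scaler0 addr0.
  rewrite p0; apply: le_trans (H_lower_scalar _ n0).
  have : 0 <= - (g1 * enorm x) by rewrite oppr_ge0 mulr_le0_ge0// enorm_ge0.
  lra.
apply: le_trans (H_lower_ge n0 sX p0).
have -> : enorm p = - (2 * g1 * enorm x).
  by rewrite /p enormZ ler0_norm; [ring|lra].
rewrite /X mulmxDr mxtraceD mul_mx_scalar -scalemxAr !mxtraceZ trace_sigma1//.
rewrite trace_sigma.
have -> : \tr (x^T *m x) = dotv x x by rewrite mxtrace_mulC /mxtrace big_ord1 -dotv_mx.
rewrite quadv_tens.
have pp : dotv p p = (2 * g1) ^+ 2 * dotv x x by rewrite /p !dotvE; ring.
have -> : dotv x p = 2 * g1 * dotv x x by rewrite /p !dotvE.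
have : dotv p p != 0 by rewrite dotvv_eq0.
rewrite pp mulf_eq0 negb_or => /andP[g2 x2].
have -> : ((2 * g1) ^+ 2 * dotv x x)^-1 * (2 * g1 * dotv x x) ^+ 2 = dotv x x.
  field; rewrite x2 /=; move: g2; rewrite expf_eq0/= mulf_eq0 negb_or => /andP[_ ->] //.
lra.
Qed.

(** A superjet only requires an upper second-order expansion, so the barriers need
    not be twice differentiable. *)
Definition upper_contact (g : R -> R) (g1 c s : R) := forall e, 0 < e ->
  exists2 d, 0 < d & forall r, 0 <= r -> `|r - s| < d ->
    g r <= g s + g1 * (r - s) + (c + e) * (r - s) ^+ 2.

(** The factor 16 stems from splitting the square of [2 q + y] into
    [8 q ^+ 2 + 2 y ^+ 2]; this loss only affects the second derivative in the
    radial direction. *)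
Lemma radial_superjet (w : 'rV[R]_n * R -> R) x0 t0 (g : R -> R) (g1 c k N t1 : R) :
  0 <= c -> 0 <= N -> upper_contact g g1 c (dotv x0 x0) ->
  (exists2 d, 0 < d & forall x t, enorm (x - x0) < d -> `|t - t0| < d ->
    w (x, t) - (k * t + g (dotv x x) + N * Num.max (t - t1) 0 ^+ 2) <=
    w (x0, t0) - (k * t0 + g (dotv x0 x0) + N * Num.max (t0 - t1) 0 ^+ 2)) ->
  superjet w x0 t0 ((2 * g1) *: x0) ((2 * g1)%:M + (16 * c) *: (x0^T *m x0))
    (k + 2 * N * Num.max (t0 - t1) 0).
Proof.
move=> c0 N0 con [d d0 wmax]; apply/superjetP; split.
  by rewrite linearD/= linearZ/= tr_scalar_mx trmx_mul trmxK.
move=> e e0; set s0 := dotv x0 x0 in con wmax *.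
have s00 : 0 <= s0 by exact: dotvv_ge0.
have D0 : 0 < 8 * s0 + 2 by lra.
have e1 : 0 < e / 2 / (8 * s0 + 2) by rewrite !divr_gt0.
have [d1 d10 {}con] := con _ e1.
have [d2 d20 near2] := dotvv_near x0 d10.
have E0 : 0 < 2 * c + 1 by lra.
have F0 : 0 < N + 1 by lra.
exists (Num.min (Num.min d d2) (Num.min 1 (Num.min (e / 2 / (2 * c + 1)) (e / (N + 1))))).
  by rewrite !lt_min d0 d20 ltr01 !divr_gt0.
move=> x t; rewrite !lt_min => /andP[/andP[xd xd2] /and3P[x1 xc _]].
move=> /andP[/andP[td _] /and3P[_ _ tN]].
have {wmax} := wmax x t xd td.
have := con _ (dotvv_ge0 x) (near2 x xd2).
set y := x - x0 in xd xd2 x1 xc *.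
have -> : dotv x x - s0 = 2 * dotv x0 y + dotv y y.
  by rewrite /y !dotvE (dotvC x0 x) /s0; ring.
set Y := enorm y in x1 xc *; have Y0 : 0 <= Y by exact: enorm_ge0.
have yY : dotv y y = Y ^+ 2 by rewrite -enorm_sqr.
rewrite quadvD quadvZX quadv_tens dotvZl.
have -> : quadv (2 * g1)%:M y = 2 * g1 * dotv y y by rewrite /quadv mul_mx_scalar dotvZl.
rewrite yY; set q := dotv x0 y.
have qs : q ^+ 2 <= s0 * Y ^+ 2 by rewrite -yY; exact: cauchy_schwarz_sqr.
set eps := e / 2 / (8 * s0 + 2) in e1 *.
have Y2 : Y ^+ 2 <= Y by rewrite expr2 ler_piMr// ltW.
have Y21 : Y ^+ 2 <= 1 by apply: le_trans Y2 _; exact: ltW.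
have Y4 : Y ^+ 4 <= Y ^+ 2.
  have -> : Y ^+ 4 = Y ^+ 2 * Y ^+ 2 by ring.
  by rewrite ler_piMl// sqr_ge0.
have sq : (2 * q + Y ^+ 2) ^+ 2 <= 8 * q ^+ 2 + 2 * Y ^+ 4.
  have := sqr_ge0 (2 * q - Y ^+ 2); lra.
have G1 : c * (2 * q + Y ^+ 2) ^+ 2 <= 8 * c * q ^+ 2 + e / 2 * Y ^+ 2.
  apply: le_trans (ler_wpM2l c0 sq) _; rewrite mulrDr.
  have cY : 2 * c * Y ^+ 2 <= e / 2.
    move: xc; rewrite ltr_pdivlMr// => xc.
    have : 2 * c * Y ^+ 2 <= 2 * c * Y by rewrite ler_wpM2l// mulr_ge0.
    lra.
  have : 2 * c * Y ^+ 2 * Y ^+ 2 <= e / 2 * Y ^+ 2 by rewrite ler_wpM2r// sqr_ge0.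
  lra.
have G2 : eps * (2 * q + Y ^+ 2) ^+ 2 <= e / 2 * Y ^+ 2.
  apply: (@le_trans _ _ (eps * ((8 * s0 + 2) * Y ^+ 2))).
    by rewrite ler_wpM2l ?(ltW e1)//; lra.
  by rewrite /eps mulrA divfK ?gt_eqF.
have := posD_le (t0 - t1) (t - t0).
have -> : t0 - t1 + (t - t0) = t - t1 by ring.
set P0 := Num.max (t0 - t1) 0; set P1 := Num.max (t - t1) 0 => H.
have {H} G3 : N * P1 ^+ 2 <= N * P0 ^+ 2 + 2 * N * P0 * (t - t0) + e * `|t - t0|.
  apply: le_trans (ler_wpM2l N0 H) _.
  have : N * (t - t0) ^+ 2 <= e * `|t - t0|.
    rewrite -real_normK ?num_real// expr2 mulrA ler_wpM2r//.
    move: tN; rewrite ltr_pdivlMr//; have := normr_ge0 (t - t0); lra.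
  lra.
move: G1 G2 G3; clear -n0 n1 e0; lra.
Qed.

(** The barrier dominates on the boundary of a space-time cylinder: at the inner
    sphere by its blow-up, at the outer one and at the initial time because [U] is
    nonpositive there, at the top by the quadratic penalty in time. A positive maximum of the difference
    is thus attained inside, where the jet of the barrier contradicts its strict
    inequality. As the barrier is explicit, no doubling of variables is needed. *)
Lemma comparison_usc (U : 'rV[R]_n * R -> R) (h : R -> R) (a k : R) (g g1 c : R -> R) :
  (forall z b, ST z -> U z < b -> \forall w \near within ST (nbhs z), U w < b) ->
  (forall x, U (x, 0) <= 0) ->
  (forall T : R, 0 < T -> exists2 r : R, 0 < r & forall x (t : R),
     r < enorm x -> 0 <= t -> t < T -> U (x, t) <= 0) ->
  (forall x0 t0 p (X : 'M[R]_n) tau, 0 < t0 -> superjet U x0 t0 p X tau ->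
     tau + H_lower p X <= h (enorm x0)) ->
  0 <= k ->
  (forall s, a < s -> 0 <= s -> [/\ 0 <= g s, g1 s <= 0, 0 <= c s, g1 s = 0 -> c s = 0 &
      upper_contact g (g1 s) (c s) s]) ->
  (forall s, a < s -> 0 <= s -> g r @[r --> s] --> g s) ->
  (forall s, a < s -> 0 <= s -> h (Num.sqrt s) < k - 2 * g1 s * (n%:R - 1 - Num.sqrt s)) ->
  (forall N, exists2 a', a < a' & forall s, a < s -> 0 <= s -> s <= a' -> N <= g s) ->
  forall x (t : R), 0 <= t -> a < dotv x x -> U (x, t) <= k * t + g (dotv x x).
Proof.
move=> U_usc U_init U_supp sub k0 gP gc strict blow x1 t1 t10 ax1; rewrite leNgt; apply/negP => bad.
have T0 : 0 < t1 + 2 by lra.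
have [RT RT0 U_far] := U_supp _ T0.
pose T := t1 + 1.
pose r := RT + enorm x1 + 1.
have r0 : 0 < r by rewrite /r; have := enorm_ge0 x1; lra.
have x1r : dotv x1 x1 <= r ^+ 2.
  rewrite -enorm_sqr ler_pXn2r ?nnegrE ?enorm_ge0//; last exact: ltW.
  by rewrite /r; lra.
have cylinder_max (b : R) (w : 'rV[R]_n * R -> R) z1 :
    let K := [set x : 'rV[R]_n | b <= dotv x x /\ dotv x x <= r ^+ 2] `*` `[0, T] in
    K z1 -> (forall z, K z -> forall b, w z < b ->
      \forall z' \near within K (nbhs z), w z' < b) ->
    exists2 z, K z & forall z', K z' -> w z' <= w z.
  move=> K Kz1 wusc; apply: usc_compact_max wusc; last by exists z1.
  by apply: compact_setX; [exact: annulus_compact|exact: segment_compact].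
have K_ST b : [set x : 'rV[R]_n | b <= dotv x x /\ dotv x x <= r ^+ 2] `*` `[0, T] `<=` ST.
  by move=> z [_ /=]; rewrite in_itv/= => /andP[].
have [B0 [B00 UB]] : exists B0, 0 <= B0 /\ forall x t, dotv x x <= r ^+ 2 -> 0 <= t -> t <= T ->
    U (x, t) <= B0.
  have [||z _ zmax] := cylinder_max (-1) U (x1, t1).
  - split; first by split=> //=; have := dotvv_ge0 x1; lra.
    by rewrite /= in_itv/= t10 /T; lra.
  - move=> z Kz b Ub; have := U_usc _ _ (K_ST _ _ Kz) Ub.
    rewrite /within/=; apply: (@filterS _ _ (nbhs_filter z)) => y H Ky.
    exact: (H (K_ST _ _ Ky)).
  exists (Num.max 0 (U z)); rewrite le_max lexx; split=> // x t xr t0 tT.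
  rewrite le_max; apply/orP; right; apply: zmax; split=> /=.
    by split=> //; have := dotvv_ge0 x; lra.
  by rewrite in_itv/= t0.
pose N := B0 + 1.
have N0 : 0 < N by rewrite /N; lra.
have [a' aa' ga'] := blow N.
pose psi (z : 'rV[R]_n * R) :=
  k * z.2 + g (dotv z.1 z.1) + N * Num.max (z.2 - t1) 0 ^+ 2.
pose K := [set x : 'rV[R]_n | a' <= dotv x x /\ dotv x x <= r ^+ 2] `*` `[0, T].
pose Phi z := U z - psi z.
have P1 : 0 < U (x1, t1) - psi (x1, t1).
  rewrite /psi/= subrr maxxx expr0n/= mulr0 addr0 subr_gt0.
  exact: bad.
have psi_ge x (t : R) : a < dotv x x -> 0 <= t ->
    [/\ 0 <= psi (x, t), (dotv x x <= a' -> N <= psi (x, t)) & (t = T -> N <= psi (x, t))].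
  move=> ax t0; have [g0 _ _ _ _] := gP _ ax (dotvv_ge0 x).
  have kt : 0 <= k * t by rewrite mulr_ge0.
  have Nt : 0 <= N * Num.max (t - t1) 0 ^+ 2 by rewrite mulr_ge0 ?sqr_ge0// ltW.
  rewrite /psi/=; split.
  - by rewrite !addr_ge0.
  - move=> xa; have := ga' _ ax (dotvv_ge0 x) xa; lra.
  - move=> tT; have : N * Num.max (t - t1) 0 ^+ 2 = N.
      by rewrite tT /T addrAC subrr add0r max_l ?ler01// expr1n mulr1.
    by lra.
have t1T : t1 <= T by rewrite /T; lra.
have K1 : K (x1, t1).
  split=> /=; last by rewrite in_itv/= t10.
  split=> //; rewrite leNgt; apply/negP => xa.
  have [_ /(_ (ltW xa)) H _] := psi_ge x1 t1 ax1 t10.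
  have := UB x1 t1 x1r t10 t1T; move: P1 H; rewrite /N; lra.
have Phi_usc z : K z -> forall b, Phi z < b -> \forall y \near within K (nbhs z), Phi y < b.
  case: z => x0 t0 Kz b Pb.
  have [/= [ax0 x0r] _] := Kz.
  have ax0' : a < dotv x0 x0 by exact: lt_le_trans ax0.
  have [e e0 eE] : exists2 e, 0 < e & b = Phi (x0, t0) + e + e.
    exists ((b - Phi (x0, t0)) / 2); first by rewrite divr_gt0// subr_gt0.
    by rewrite -addrA -splitr addrC subrK.
  have Ue : U (x0, t0) < U (x0, t0) + e by rewrite ltrDl.
  have /nbhs_rVRP[d1 d10 near1] := U_usc _ _ (K_ST _ _ Kz) Ue.
  have [d2 d20 near2] := penalty_lsc t1 t0 (gc _ ax0' (dotvv_ge0 x0)) k0 (ltW N0) e0.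
  apply/nbhs_rVRP; exists (Num.min d1 d2); first by rewrite lt_min d10.
  move=> x t; rewrite !lt_min => /andP[xd1 xd2] /andP[td1 td2] Kxt.
  rewrite eE /Phi ltrBlDr.
  have -> : U (x0, t0) - psi (x0, t0) + e + e + psi (x, t) =
      (U (x0, t0) + e) + (psi (x, t) - (psi (x0, t0) - e)) by ring.
  apply: ltr_wpDr; last exact: (near1 x t xd1 td1 (K_ST _ _ Kxt)).
  by rewrite subr_ge0 ltW// near2.
have [[x0 t0] Kz zmax] := cylinder_max a' Phi (x1, t1) K1 Phi_usc.
have Pz : 0 < U (x0, t0) - psi (x0, t0) by apply: lt_le_trans P1 _; exact: zmax.
have [/= [ax0 x0r]] := Kz; rewrite in_itv/= => /andP[t00 t0T].
have ax0' : a < dotv x0 x0 by exact: lt_le_trans ax0.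
have [psi0 psia psiT] := psi_ge x0 t0 ax0' t00.
have UBz := UB x0 t0 x0r t00 t0T.
have t0p : 0 < t0.
  rewrite lt_neqAle t00 andbT; apply/eqP => t0E; have := U_init x0.
  by move: Pz psi0; rewrite -t0E; lra.
have t0lt : t0 < T.
  rewrite lt_neqAle t0T andbT; apply/eqP => /psiT.
  by move: Pz UBz; rewrite /N; lra.
have x0lt : enorm x0 < r.
  rewrite ltNge; apply/negP => rx; have : U (x0, t0) <= 0.
    by apply: U_far => //; move: rx t0T; rewrite /r /T; have := enorm_ge0 x1; lra.
  by move: Pz psi0; lra.
have x0a : a' < dotv x0 x0.
  rewrite lt_neqAle ax0 andbT; apply/eqP => xa.
  have := psia; rewrite -xa lexx => /(_ isT); move: Pz UBz; rewrite /N; lra.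
have [_ g10 c0 gc0 con] := gP _ ax0' (dotvv_ge0 x0).
have jet : superjet U x0 t0 ((2 * g1 (dotv x0 x0)) *: x0)
    ((2 * g1 (dotv x0 x0))%:M + (16 * c (dotv x0 x0)) *: (x0^T *m x0))
    (k + 2 * N * Num.max (t0 - t1) 0).
  apply: radial_superjet c0 (ltW N0) con _.
  have m0 : 0 < Num.min (dotv x0 x0 - a') (r ^+ 2 - dotv x0 x0).
    rewrite lt_min !subr_gt0 x0a -enorm_sqr ltr_pXn2r ?nnegrE ?enorm_ge0//.
    exact: ltW.
  have [d d0 near] := dotvv_near x0 m0.
  exists (Num.min d (Num.min t0 (T - t0))).
    by rewrite !lt_min d0 t0p subr_gt0.
  move=> x t; rewrite !lt_min => /andP[/near xd _] /and3P[_ td tT].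
  apply: (zmax (x, t)); split=> /=.
    move: xd; rewrite lt_min !ltr_distl => /andP[/andP[h1 _] /andP[_ h4]].
    rewrite subKr in h1; rewrite addrC subrK in h4.
    by split; exact: ltW.
  rewrite in_itv/=; move: td tT; rewrite !ltr_distl subrr => /andP[h1 _] /andP[_ h4].
  by rewrite addrC subrK in h4; rewrite !ltW.
have := sub _ _ _ _ _ t0p jet.
have := H_lower_radial x0 g10 gc0.
have := strict _ ax0' (dotvv_ge0 x0); rewrite -/(enorm x0).
have : 0 <= 2 * N * Num.max (t0 - t1) 0.
  by rewrite mulr_ge0 ?le_max ?lexx ?orbT// mulr_ge0// ltW.
move: (H_lower _ _) (h _) (2 * N * _) => HH hh NN; lra.
Qed.

Section Subsolution.
Variables (h : R -> R) (M : R).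
Hypothesis h_ge0 : forall r : R, 0 <= r -> 0 <= h r.
Hypothesis h_le : forall r : R, 0 <= r -> h r <= M.
Hypothesis h_usc : upper_semicontinuous_on [set r : R | 0 <= r] h.
Variable u : 'rV[R]_n * R -> R.
Hypothesis u_sub : viscosity_subsolution (fun x => h (enorm x)) (fun=> 0) u.
Hypothesis u_supp : compactly_supported_in_space u.

Let U := upper_env ST u.
Let u_bnd z : ST z -> bounded_near u (within ST (nbhs z)).
Proof. by case: u_sub => + _ _; apply. Qed.

Lemma upper_env_usc z a : ST z -> U z < a -> \forall w \near within ST (nbhs z), U w < a.
Proof.
move=> Sz Ua; have FF := within_proper Sz.
have Um : U z < (U z + a) / 2 by lra.
have ma : (U z + a) / 2 < a by lra.
have := upper_env_lt FF (u_bnd Sz) Um; rewrite /within/= => /nbhs_interior.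
apply: filterS => w /= wu Sw; apply: le_lt_trans ma.
have FW := within_proper Sw.
apply: upper_env_le; first exact: u_bnd.
by apply: filterS wu => y H Sy; apply/ltW/H.
Qed.

Lemma upper_rhs_le x : upper_env setT (fun y => h (enorm y)) x <= h (enorm x).
Proof.
have FF : ProperFilter (within setT (nbhs x)) by exact: within_proper.
apply/ler_addgt0Pr => e e0; apply: upper_env_le.
  exact: (rhs_bounded h_ge0 h_le).
have [d d0 H] := rhs_usc h_usc x e0.
have [d' d'0 near] := dotvv_near x d0.
apply/nbhs_rVP; exists d' => // y /near yx _.
by have [] := H _ (dotvv_ge0 y) yx.
Qed.

(** The upper envelope of a compactly supported subsolution satisfies all the
    hypotheses of [comparison_usc]. *)
Lemma comparison (a k : R) (g g1 c : R -> R) : 0 <= k ->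
  (forall s, a < s -> 0 <= s -> [/\ 0 <= g s, g1 s <= 0, 0 <= c s, g1 s = 0 -> c s = 0 &
      upper_contact g (g1 s) (c s) s]) ->
  (forall s, a < s -> 0 <= s -> g r @[r --> s] --> g s) ->
  (forall s, a < s -> 0 <= s -> h (Num.sqrt s) < k - 2 * g1 s * (n%:R - 1 - Num.sqrt s)) ->
  (forall N, exists2 a', a < a' & forall s, a < s -> 0 <= s -> s <= a' -> N <= g s) ->
  forall x (t : R), 0 <= t -> a < dotv x x -> u (x, t) <= k * t + g (dotv x x).
Proof.
move=> k0 gP gc strict blow x t t0 ax.
have Sxt : ST (x, t) by [].
apply: le_trans (upper_env_ge Sxt (u_bnd Sxt)) _.
apply: (comparison_usc (h := h)) gP gc strict blow _ _ t0 ax => //.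
- by move=> z b; exact: upper_env_usc.
- by case: u_sub.
- move=> T T0; have [RT RT0 out] := u_supp T0.
  exists RT => // y s yR s0 sT; have Sz : ST (y, s) by [].
  have FF := within_proper Sz; apply: upper_env_le; first exact: u_bnd.
  apply/nbhs_rVRP; exists (Num.min (enorm y - RT) (T - s)).
    by rewrite lt_min !subr_gt0 yR.
  move=> z r; rewrite !lt_min => /andP[zy _] /andP[_ rs] S0.
  rewrite out//.
    move=> zR; have : enorm y <= enorm (y - z) + enorm z by rewrite -{1}(subrK z y) enormD.
    by rewrite -(enormN (y - z)) opprB; lra.
  move: S0; rewrite /ST/spacetime/= => -> /=.
  by move: rs; rewrite ltr_norml => /andP[_]; lra.
- case: u_sub => _ _ jets x0 t1 p X tau t10 jet.
  by apply: le_trans (jets _ _ _ _ _ t10 jet) _; exact: upper_rhs_le.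
Qed.
End Subsolution.
End Comparison.

(** * Two barriers *)

Section Barriers.
Variable R : realType.
Implicit Types (s a A B : R).

Definition cubic_barrier A s1 s : R := A * Num.max (s1 - s) 0 ^+ 3.

Lemma pos_cube_le (a h : R) : Num.max (a + h) 0 ^+ 3 <=
  Num.max a 0 ^+ 3 + 3 * Num.max a 0 ^+ 2 * h + (3 * Num.max a 0 + `|h|) * h ^+ 2.
Proof.
have h3 : h ^+ 3 <= `|h| * h ^+ 2.
  by rewrite exprS ler_wpM2r ?sqr_ge0// ler_norm.
have [a0|a0] := leP a 0; have [ah|ah] := leP (a + h) 0.
- by rewrite !expr0n/= !(mulr0, mul0r, add0r) mulr_ge0// sqr_ge0.
- rewrite !expr0n/= !(mulr0, mul0r, add0r); apply: le_trans h3.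
  rewrite ler_pXn2r ?nnegrE//; lra.
- have h0 : h <= 0 by lra.
  rewrite expr0n/= ler0_norm//.
  have ahh : (- h - a) ^+ 3 <= (- h) ^+ 3 by rewrite ler_pXn2r ?nnegrE//; lra.
  have : 0 <= (- h) ^+ 3 by rewrite exprn_ge0//; lra.
  move: ahh; lra.
- have -> : (a + h) ^+ 3 = a ^+ 3 + 3 * a ^+ 2 * h + 3 * a * h ^+ 2 + h ^+ 3 by ring.
  by lra.
Qed.

Lemma cubic_barrier_contact A s1 s : 0 < A ->
  upper_contact (cubic_barrier A s1) (- (3 * A * Num.max (s1 - s) 0 ^+ 2))
    (3 * A * Num.max (s1 - s) 0) s.
Proof.
move=> A0 e e0; exists (e / A); first by rewrite divr_gt0.
move=> r _; rewrite ltr_pdivlMr// => rs; rewrite /cubic_barrier.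
have := ler_wpM2l (ltW A0) (pos_cube_le (s1 - s) (s - r)).
have -> : s1 - s + (s - r) = s1 - r by ring.
rewrite (distrC s r) => H.
have : `|r - s| * A * (s - r) ^+ 2 <= e * (s - r) ^+ 2.
  by rewrite ler_wpM2r ?sqr_ge0// ltW.
by move: H; move: (Num.max _ _) (Num.max _ _) (`|_|) => *; lra.
Qed.

Lemma cubic_barrier_cvg A s1 s :
  cubic_barrier A s1 r @[r --> s] --> cubic_barrier A s1 s.
Proof.
have pc : Num.max (s1 - r) 0 @[r --> s] --> Num.max (s1 - s) 0.
  apply: (@continuous_max _ _ (fun r : R => s1 - r) (fun=> 0) s).
    by apply: cvgB; [exact: cvg_cst|exact: cvg_id].
  exact: cvg_cst.
exact: (cvgM (cvg_cst A) (cvgM pc (cvgM pc pc))).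
Qed.

(** At full inward speed a path needs a time of order [- ln (s - a)] to come within
    [s - a] of the critical sphere, where [a] is its squared radius. The barrier is
    [B] times this time, corrected to stay nonnegative at infinity. *)
Definition log_barrier B a s : R := B * (ln (1 + (s - a)) - ln (s - a)).

Lemma log_barrier_ge0 B a s : 0 <= B -> a < s -> 0 <= log_barrier B a s.
Proof.
move=> B0 as0; rewrite mulr_ge0// subr_ge0 ler_ln ?posrE; lra.
Qed.

(** Both logarithms are estimated by [ln (1 + x) <= x], whose error is of second
    order and enters the coefficient of the square. *)
Lemma log_barrier_contact B a s : 0 <= B -> a < s ->
  upper_contact (log_barrier B a) (- (B / ((s - a) * (1 + (s - a)))))
    (2 * B / (s - a) ^+ 2) s.
Proof.
move=> B0 as0 e e0; pose w := s - a.
have w0 : 0 < w by rewrite /w subr_gt0.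
have w1 : 0 < 1 + w by rewrite ltr_wpDl.
exists (w / 2); first by rewrite divr_gt0.
move=> r _ rs; pose d := r - s.
have dw : `|d| < w / 2 by [].
have [d1 d2] : - (w / 2) < d /\ d < w / 2 by move: dw; rewrite ltr_norml => /andP[].
have ra : r - a = w + d by rewrite /w /d; ring.
rewrite /log_barrier ra -/w -/d.
have wd : 0 < w + d by lra.
have L1 : ln (1 + (w + d)) <= ln (1 + w) + d / (1 + w).
  have -> : 1 + (w + d) = (1 + w) * (1 + d / (1 + w)) by field; rewrite gt_eqF.
  have dd : -1 < d / (1 + w) by rewrite ltr_pdivlMr//; lra.
  rewrite lnM ?posrE//; last by lra.
  by rewrite lerD2l le_ln1Dx.
have L2 : ln w + d / (w + d) <= ln (w + d).
  have wE : w = (w + d) * (1 + - (d / (w + d))) by field; rewrite gt_eqF.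
  have dd : -1 < - (d / (w + d)).
    by rewrite ltrN2 ltr_pdivrMr//; lra.
  rewrite {1}wE lnM ?posrE//; last by lra.
  by have := le_ln1Dx dd; lra.
have L3 : d / w - 2 * (d / w) ^+ 2 <= d / (w + d).
  rewrite -subr_ge0.
  have -> : d / (w + d) - (d / w - 2 * (d / w) ^+ 2) =
      (d / w) ^+ 2 * ((w + 2 * d) / (w + d)) by field; rewrite !gt_eqF.
  by rewrite mulr_ge0 ?sqr_ge0// divr_ge0 ?(ltW wd)//; lra.
have : B * (ln (1 + (w + d)) - ln (w + d)) <=
    B * (ln (1 + w) - ln w + (d / (1 + w) - d / w) + 2 * (d / w) ^+ 2).
  by rewrite ler_wpM2l//; lra.
move=> /le_trans; apply.
have -> : B * (ln (1 + w) - ln w + (d / (1 + w) - d / w) + 2 * (d / w) ^+ 2) =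
  B * (ln (1 + w) - ln w) + - (B / (w * (1 + w))) * d + 2 * B / w ^+ 2 * d ^+ 2.
  by field; rewrite !gt_eqF.
by rewrite lerD2l ler_wpM2r ?sqr_ge0// lerDl ltW.
Qed.

Lemma log_barrier_cvg B a s : a < s -> log_barrier B a r @[r --> s] --> log_barrier B a s.
Proof.
move=> as0; have w0 : 0 < s - a by rewrite subr_gt0.
have idc (b : R) : {for s, continuous (fun r : R => b + (r - a))}.
  apply: (cvgD (cvg_cst b)); apply: cvgB; [exact: cvg_id|exact: cvg_cst].
have lnc (b : R) : 0 < b + (s - a) -> ln (b + (r - a)) @[r --> s] --> ln (b + (s - a)).
  by move=> b0; exact: (continuous_comp (idc b) (continuous_ln b0)).
have l0 := lnc 0; rewrite add0r in l0.
have {}l0 : ln (r - a) @[r --> s] --> ln (s - a).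
  by have := l0 w0; under eq_cvg do rewrite add0r.
have w1 : 0 < 1 + (s - a) by lra.
exact: (cvgM (cvg_cst B) (cvgB (lnc 1 w1) l0)).
Qed.

Lemma log_barrier_blowup B a : 0 < B -> forall N, exists2 a', a < a' &
  forall s, a < s -> 0 <= s -> s <= a' -> N <= log_barrier B a s.
Proof.
move=> B0 N; exists (a + expR (- (N / B))); first by rewrite ltrDl expR_gt0.
move=> s as0 _ sa; have w0 : 0 < s - a by rewrite subr_gt0.
have l1 : 0 <= ln (1 + (s - a)) by rewrite ln_ge0; lra.
have l2 : ln (s - a) <= - (N / B).
  by rewrite -[leRHS]expRK ler_ln ?posrE ?expR_gt0//; lra.
have -> : N = B * (N / B) by rewrite mulrC divfK// gt_eqF.
by rewrite /log_barrier ler_wpM2l ?(ltW B0)//; lra.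
Qed.

Lemma log_barrier_le B a s kap : 0 < B -> 0 < kap -> a + kap <= s ->
  log_barrier B a s <= B / kap.
Proof.
move=> B0 k0 ks; have w0 : 0 < s - a by lra.
rewrite /log_barrier ler_wpM2l ?(ltW B0)//.
have -> : 1 + (s - a) = (s - a) * (1 + (s - a)^-1) by rewrite mulrDr mulr1 mulfV ?gt_eqF// addrC.
have i0 : 0 < (s - a)^-1 by rewrite invr_gt0.
rewrite lnM ?posrE//; last by lra.
rewrite addrAC subrr add0r; apply: le_trans (le_ln1Dx _) _; first by lra.
by rewrite lef_pV2 ?posrE//; lra.
Qed.
End Barriers.

(** * Bounds for the growth rate *)

Section Growth.
Variables (R : realType) (n : nat) (h : R -> R) (M : R).
Hypothesis n1 : (1 < n)%N.
Hypothesis h_ge0 : forall r : R, 0 <= r -> 0 <= h r.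
Hypothesis h_le : forall r : R, 0 <= r -> h r <= M.
Hypothesis h_usc : upper_semicontinuous_on [set r : R | 0 <= r] h.
Implicit Types (x : 'rV[R]_n) (s t : R).

Let ncrit : R := n%:R - 1.

Let ncrit_ge1 : 1 <= ncrit.
Proof. by rewrite /ncrit lerBrDr -(natrD _ 1 1) ler_nat. Qed.

(** A radius [r0] of at least [n - 1] can be held for ever, because the outward
    drift [(n - 1) / r0] does not exceed the control bound; this earns [h r0] per
    unit of time after the sphere has been reached in one step. *)
Lemma value_wait r0 s t d : ncrit <= r0 -> 0 <= s -> 0 <= d -> d <= t ->
  `|r0 ^+ 2 - s - 2 * ncrit * d| <= 2 * d * Num.sqrt (Num.min s (r0 ^+ 2)) ->
  (t - d) * h r0 <= value n h s t.
Proof.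
move=> nr s0 d0 dt step; have r00 : 0 <= r0 by move: ncrit_ge1; lra.
have rr0 : 0 <= r0 ^+ 2 by rewrite sqr_ge0.
have wait : (t - d) * h r0 <= value n h (r0 ^+ 2) (t - d).
  have td : 0 <= t - d by rewrite subr_ge0.
  have := @value_step _ _ _ n1 h_ge0 _ h_le (r0 ^+ 2) (r0 ^+ 2) (t - d) 0 (h r0) rr0 rr0 td (lexx _).
  have -> : r0 ^+ 2 - r0 ^+ 2 - 2 * (n%:R - 1) * (t - d) = - (2 * ncrit * (t - d)) by rewrite /ncrit; ring.
  rewrite minxx maxxx sqrtr_sqr (ger0_norm r00) addr0 normrN ger0_norm; last first.
    by rewrite mulr_ge0// mulr_ge0//; move: ncrit_ge1; lra.
  have -> : 2 * ncrit * (t - d) = 2 * (t - d) * ncrit by ring.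
  rewrite ler_wpM2l ?mulr_ge0// => /(_ isT) H.
  have v0 : 0 <= value n h (r0 ^+ 2) 0 by apply: (value_ge0 n1 h_ge0 h_le).
  apply: le_trans (H _); first by rewrite lerDr.
  move=> rho r1 r2; have -> : rho = r0 ^+ 2 by apply/eqP; rewrite eq_le r2.
  by rewrite sqrtr_sqr ger0_norm.
apply: le_trans wait _.
have := @value_step _ _ _ n1 h_ge0 _ h_le s (r0 ^+ 2) d (t - d) 0 s0 rr0 d0.
rewrite subr_ge0 mulr0 addr0 (addrC d) subrK => /(_ dt step); apply.
by move=> rho _ _; exact: h_ge0 (sqrtr_ge0 _).
Qed.

(** From inside the ball of radius [r0], coasting outwards reaches the sphere of
    radius [r0] in bounded time. *)
Lemma value_lower_inside r0 s t : ncrit <= r0 -> 0 <= s -> s <= r0 ^+ 2 -> 0 <= t ->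
  h r0 * t - h r0 * (r0 ^+ 2 / (2 * ncrit)) <= value n h s t.
Proof.
move=> nr s0 sr t0; have r00 : 0 <= r0 by move: ncrit_ge1; lra.
have b0 : 0 < 2 * ncrit by move: ncrit_ge1; lra.
pose d := (r0 ^+ 2 - s) / (2 * ncrit).
have dE : 2 * ncrit * d = r0 ^+ 2 - s by rewrite /d mulrC divfK ?gt_eqF.
have d0 : 0 <= d by rewrite /d divr_ge0 ?(ltW b0)// subr_ge0.
have dT : d <= r0 ^+ 2 / (2 * ncrit).
  by rewrite /d ler_pM2r ?invr_gt0//; lra.
have hT : h r0 * d <= h r0 * (r0 ^+ 2 / (2 * ncrit)) by rewrite ler_wpM2l// h_ge0.
have [dt|td] := leP d t.
  have : (t - d) * h r0 <= value n h s t.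
    apply: value_wait => //; rewrite dE subrr normr0.
    by rewrite mulr_ge0 ?sqrtr_ge0// mulr_ge0.
  lra.
have : h r0 * t <= h r0 * d by rewrite ler_wpM2l ?h_ge0// ltW.
have := value_ge0 n1 h_ge0 h_le s0 t0; lra.
Qed.

(** From outside, a sphere of supercritical radius is reached at full inward speed. *)
Lemma value_lower_outside r0 s t : ncrit < r0 -> r0 ^+ 2 <= s -> 0 <= t ->
  h r0 * t - h r0 * (s / (2 * (r0 - ncrit))) <= value n h s t.
Proof.
move=> nr rs t0; have r00 : 0 <= r0 by move: ncrit_ge1; lra.
have rr0 : 0 <= r0 ^+ 2 by rewrite sqr_ge0.
have s0 : 0 <= s by exact: le_trans rs.
have b0 : 0 < 2 * (r0 - ncrit) by lra.
pose d := (s - r0 ^+ 2) / (2 * (r0 - ncrit)).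
have dE : 2 * (r0 - ncrit) * d = s - r0 ^+ 2 by rewrite /d mulrC divfK ?gt_eqF.
have d0 : 0 <= d by rewrite /d divr_ge0 ?(ltW b0)// subr_ge0.
have dT : d <= s / (2 * (r0 - ncrit)).
  by rewrite /d ler_pM2r ?invr_gt0//; lra.
have hT : h r0 * d <= h r0 * (s / (2 * (r0 - ncrit))) by rewrite ler_wpM2l// h_ge0.
have [dt|td] := leP d t.
  have : (t - d) * h r0 <= value n h s t.
    apply: value_wait => //; first exact: ltW.
    rewrite min_r// sqrtr_sqr (ger0_norm r00).
    have -> : r0 ^+ 2 - s = - (2 * (r0 - ncrit) * d) by rewrite dE opprB.
    have -> : - (2 * (r0 - ncrit) * d) - 2 * ncrit * d = - (2 * d * r0) by ring.
    by rewrite normrN ger0_norm// mulr_ge0// mulr_ge0.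
  lra.
have : h r0 * t <= h r0 * d by rewrite ler_wpM2l ?h_ge0// ltW.
have := value_ge0 n1 h_ge0 h_le s0 t0; lra.
Qed.

Section Upper.
Variable u : 'rV[R]_n * R -> R.
Hypothesis u_sub : viscosity_subsolution (fun x => h (enorm x)) (fun=> 0) u.
Hypothesis u_supp : compactly_supported_in_space u.

(** Strictly inside the critical ball a steep decreasing barrier absorbs the source;
    near and beyond the critical radius the source is at most [c1 + e]. *)
Lemma growth_upper c1 e : 0 <= c1 -> 0 < e -> (forall r, ncrit <= r -> h r <= c1) ->
  exists C, forall x t, 0 <= t -> u (x, t) <= (c1 + e) * t + C.
Proof.
move=> c10 e0 hc; have n00 : 0 <= ncrit by move: ncrit_ge1; lra.
have hn : h ncrit < c1 + e by apply: le_lt_trans (hc _ (lexx _)) _; rewrite ltrDl.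
have /nbhs_ballP[d /= d0 hd] := h_usc n00 hn.
pose eta := Num.min (d / 2) (ncrit / 2).
have [eta0 [etad etan]] : 0 < eta /\ eta < d /\ eta < ncrit.
  rewrite /eta; split; first by rewrite lt_min; move: ncrit_ge1; lra.
  by split; rewrite gt_min; apply/orP; [left|right]; move: ncrit_ge1; lra.
have near r : ncrit - eta < r -> h r < c1 + e.
  move=> rn; have [nr|rn'] := leP ncrit r.
    by apply: le_lt_trans (hc _ nr) _; rewrite ltrDl.
  apply: hd; last by rewrite /=; lra.
  by rewrite /ball/= ger0_norm; lra.
pose q1 := ncrit - eta / 2; pose q2 := ncrit - eta.
have [q20 q21] : 0 < q2 /\ q2 < q1 by rewrite /q1 /q2; split; lra.
pose D := q1 ^+ 2 - q2 ^+ 2.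
have D0 : 0 < D by rewrite subr_gt0 ltr_pXn2r ?nnegrE//; lra.
have M0 : 0 <= M by apply: le_trans (h_le n00); exact: h_ge0.
pose A := (M + 1) / (6 * D ^+ 2 * eta).
have DD : 0 < 6 * D ^+ 2 * eta by rewrite mulr_gt0// mulr_gt0// exprn_gt0.
have A0 : 0 < A by rewrite divr_gt0// ltr_wpDl.
have AE : 6 * A * D ^+ 2 * eta = M + 1.
  have -> : 6 * A * D ^+ 2 * eta = A * (6 * D ^+ 2 * eta) by ring.
  by rewrite divfK ?gt_eqF.
have k0 : 0 <= c1 + e by lra.
exists (cubic_barrier A (q1 ^+ 2) 0) => x t t0.
have m1 : -1 < dotv x x by have := dotvv_ge0 x; lra.
apply: le_trans (@comparison _ _ n1 h M h_ge0 h_le h_usc u u_sub u_supp (-1) (c1 + e)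
  (cubic_barrier A (q1 ^+ 2)) (fun s => - (3 * A * Num.max (q1 ^+ 2 - s) 0 ^+ 2))
  (fun s => 3 * A * Num.max (q1 ^+ 2 - s) 0) k0 _ _ _ _ x t t0 m1) _.
- move=> s _ s0; have P0 : 0 <= Num.max (q1 ^+ 2 - s) 0 by rewrite le_max lexx orbT.
  have A30 : 0 < 3 * A by rewrite mulr_gt0.
  split.
  + by rewrite mulr_ge0 ?exprn_ge0// ltW.
  + by rewrite oppr_le0 mulr_ge0 ?sqr_ge0// ltW.
  + by rewrite mulr_ge0// ltW.
  + by move=> /eqP; rewrite oppr_eq0 mulf_eq0 gt_eqF//= sqrf_eq0 => /eqP ->; rewrite mulr0.
  + exact: cubic_barrier_contact.
- by move=> s _ _; exact: cubic_barrier_cvg.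
- move=> s _ s0; have r00 := sqrtr_ge0 s; have rs := sqr_sqrtr s0.
  set r := Num.sqrt s in r00 rs *; rewrite -rs -/ncrit.
  have [qr|rq] := leP q1 r.
    rewrite (max_r (_ : q1 ^+ 2 - r ^+ 2 <= 0)); last first.
      by rewrite subr_le0 ler_pXn2r ?nnegrE//; lra.
    rewrite expr0n/= !(mulr0, oppr0, mul0r, subr0).
    by apply: near; move: qr; rewrite /q1; lra.
  have P0 : 0 < q1 ^+ 2 - r ^+ 2 by rewrite subr_gt0 ltr_pXn2r ?nnegrE//; lra.
  rewrite max_l ?(ltW P0)//; set P := q1 ^+ 2 - r ^+ 2 in P0 *.
  have -> : c1 + e - 2 * - (3 * A * P ^+ 2) * (ncrit - r) =
      c1 + e + 6 * A * P ^+ 2 * (ncrit - r) by ring.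
  have nr0 : 0 < ncrit - r by move: rq; rewrite /q1; lra.
  have APn : 0 <= 6 * A * P ^+ 2 by rewrite mulr_ge0 ?sqr_ge0// mulr_ge0// ltW.
  have [rq2|rq2] := leP r q2; last first.
    by apply: ltr_wpDr; [rewrite mulr_ge0// ltW|exact: near].
  have DP : D <= P by rewrite /D /P lerD2l lerN2 ler_pXn2r ?nnegrE//; lra.
  have DP2 : D ^+ 2 <= P ^+ 2 by rewrite ler_pXn2r ?nnegrE//; exact: ltW.
  have etar : eta <= ncrit - r by move: rq2; rewrite /q2; lra.
  have : 6 * A * D ^+ 2 * eta <= 6 * A * P ^+ 2 * (ncrit - r).
    apply: ler_pM => //; last by rewrite ler_wpM2l// mulr_ge0// ltW.
      by rewrite mulr_ge0 ?sqr_ge0// mulr_ge0// ltW.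
    exact: ltW.
  have := h_le r00; rewrite AE; lra.
- move=> N; exists (- (1 / 2)); first by lra.
  by move=> s _ s0 s1; lra.
- rewrite lerD2l /cubic_barrier ler_wpM2l ?(ltW A0)// lerXn2r// ?nnegrE.
  + by rewrite le_max lexx orbT.
  + by rewrite le_max lexx orbT.
  + by rewrite ge_max !le_max lexx orbT andbT lerD2l lerN2 dotvv_ge0.
Qed.

(** The barrier is infinite on the critical sphere, so that values of [h] on and
    inside it have no influence outside; its slope costs at most [2 * B], that is
    [e / 2], per unit of time. *)
Lemma growth_upper_outside c2 e kap : 0 <= c2 -> 0 < e -> 0 < kap ->
  (forall r, ncrit < r -> h r <= c2) ->
  exists C, forall x t, 0 <= t -> ncrit ^+ 2 + kap <= dotv x x ->
    u (x, t) <= (c2 + e) * t + C.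
Proof.
move=> c20 e0 kap0 hc; have k0 : 0 <= c2 + e by lra.
pose B := e / 4; have B0 : 0 < B by rewrite divr_gt0.
exists (B / kap) => x t t0 xk.
have ax : ncrit ^+ 2 < dotv x x by lra.
apply: le_trans (@comparison _ _ n1 h M h_ge0 h_le h_usc u u_sub u_supp (ncrit ^+ 2) (c2 + e)
  (log_barrier B (ncrit ^+ 2))
  (fun s => - (B / ((s - ncrit ^+ 2) * (1 + (s - ncrit ^+ 2)))))
  (fun s => 2 * B / (s - ncrit ^+ 2) ^+ 2) k0 _ _ _ _ x t t0 ax) _.
- move=> s as0 s0; have w0 : 0 < s - ncrit ^+ 2 by rewrite subr_gt0.
  have w1 : 0 < 1 + (s - ncrit ^+ 2) by rewrite ltr_wpDl.
  have g0 : 0 < B / ((s - ncrit ^+ 2) * (1 + (s - ncrit ^+ 2))) by rewrite divr_gt0// mulr_gt0.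
  split.
  + by apply: log_barrier_ge0 => //; exact: ltW.
  + by rewrite oppr_le0 ltW.
  + by rewrite divr_ge0 ?sqr_ge0// mulr_ge0// ltW.
  + by move=> gz; exfalso; move: g0; rewrite -oppr_lt0 gz ltxx.
  + by apply: log_barrier_contact => //; exact: ltW.
- by move=> s as0 _; exact: log_barrier_cvg.
- move=> s as0 s0; pose r := Num.sqrt s.
  have n00 : 0 <= ncrit by move: ncrit_ge1; lra.
  have rs : r ^+ 2 = s by rewrite sqr_sqrtr.
  have nr : ncrit < r by rewrite -(@ltr_pXn2r _ 2) ?nnegrE ?sqrtr_ge0// rs.
  have hr := hc r nr.
  rewrite -/r -rs -/ncrit.
  have w0 : 0 < r ^+ 2 - ncrit ^+ 2 by rewrite rs subr_gt0.
  set w := r ^+ 2 - ncrit ^+ 2 in w0 *.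
  have wE : w = (r - ncrit) * (r + ncrit) by rewrite /w; ring.
  have -> : 2 * - (B / (w * (1 + w))) * (ncrit - r) = 2 * B / ((r + ncrit) * (1 + w)).
    rewrite {1}wE; field; apply/and3P; split; rewrite gt_eqF//; lra.
  have : 2 * B / ((r + ncrit) * (1 + w)) <= 2 * B.
    rewrite ler_pdivrMr; last by rewrite mulr_gt0//; lra.
    rewrite ler_peMr//; first by rewrite mulr_ge0// ltW.
    by rewrite mulr_ege1//; move: ncrit_ge1; lra.
  by rewrite /B; lra.
- exact: log_barrier_blowup.
- by rewrite lerD2l; apply: log_barrier_le.
Qed.
End Upper.
End Growth.

(** * Asymptotic speed *)

Section Limits.
Variables (R : realType) (n : nat).

Lemma uniform_growth (A : set 'rV[R]_n) (u : 'rV[R]_n * R -> R) (l : R) :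
  (forall e : R, 0 < e -> exists C : R, forall x t, A x -> 0 <= t ->
    (l - e) * t - C <= u (x, t) /\ u (x, t) <= (l + e) * t + C) ->
  {uniform A, (fun x => u (x, t) / t) @[t --> +oo] --> (fun=> l)}.
Proof.
move=> H P /uniform_nbhs[E [entE EP]].
move: entE; rewrite -entourage_ballE => -[e /= e0 eE].
have e20 : 0 < e / 2 by rewrite divr_gt0.
have [C uC] := H _ e20.
exists (Num.max 1 (2 * (`|C| + 1) / e)); split; first exact: num_real.
move=> t; rewrite gt_max => /andP[t1 tC]; apply: EP => x Ax; apply: eE => /=.
have t0 : 0 < t by lra.
have [lo up] := uC x t Ax (ltW t0).
have Ct : `|C| < e / 2 * t.
  by move: tC; rewrite ltr_pdivrMr//; lra.
have [C1 C2] : - (e / 2 * t) < C /\ C < e / 2 * t by apply/andP; rewrite -ltr_norml.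
have u1 : u (x, t) / t < l + e by rewrite ltr_pdivrMr//; lra.
have u2 : l - e < u (x, t) / t by rewrite ltr_pdivlMr//; lra.
by rewrite /ball/= ltr_norml; apply/andP; split; lra.
Qed.

Lemma dotv_compact_bounds (K : set 'rV[R]_n) : compact K -> K !=set0 ->
  exists x y, [/\ K x, K y & forall z, K z -> dotv x x <= dotv z z /\ dotv z z <= dotv y y].
Proof.
move=> cK K0.
have near z (e : R) : 0 < e -> \forall y \near z, K y -> `|dotv y y - dotv z z| < e.
  move=> e0; have [d d0 yz] := dotvv_near z e0.
  by apply/nbhs_rVP; exists d => // y /yz.
have [x Kx xmin] : exists2 x, K x & forall z, K z -> - dotv z z <= - dotv x x.
  apply: usc_compact_max => // z _ a za; rewrite /within/=.
  have e0 : 0 < a + dotv z z by lra.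
  apply: filterS (near z _ e0) => y H /H.
  by rewrite ltr_norml => /andP[]; lra.
have [y Ky ymax] : exists2 x, K x & forall z, K z -> dotv z z <= dotv x x.
  apply: usc_compact_max => // z _ a za; rewrite /within/=.
  have e0 : 0 < a - dotv z z by lra.
  apply: filterS (near z _ e0) => y H /H.
  by rewrite ltr_norml => /andP[]; lra.
by exists x, y; split=> // z Kz; split; [rewrite -lerN2; exact: xmin|exact: ymax].
Qed.
End Limits.

Theorem theorem4p12 (R : realType) (n : nat) (hn : (2 <= n)%N)
    (h : R -> R)
    (h_ge0 : forall r : R, 0 <= r -> 0 <= h r)
    (h_usc : upper_semicontinuous_on [set r : R | 0 <= r] h)
    (h_supp : exists2 R0 : R, 0 < R0 &
      closure [set r : R | 0 <= r /\ h r != 0] `<=` `[0, R0])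
    (u : 'rV[R]_n * R -> R)
    (u_max : maximal_viscosity_solution (fun x => h (enorm x)) (fun=> 0) u) :
  let c1 := sup [set h r | r in `[(n%:R - 1 : R), +oo[] in
  let c2 := sup [set h r | r in `](n%:R - 1 : R), +oo[] in
  [/\ (* the supremum c1 is attained *)
      [set h r | r in `[(n%:R - 1 : R), +oo[] c1,
      {uniform closed_eball 0 (n%:R - 1),
        (fun x => u (x, t) / t) @[t --> +oo] --> (fun=> c1)}
    & locally_uniformly (~` closed_eball 0 (n%:R - 1))
        (fun t x => u (x, t) / t) (fun=> c2)].
Proof.
move=> c1 c2; have [R0 R00 supp] := h_supp.
have n1 : (1 < n)%N by [].
pose ncrit : R := n%:R - 1.
have nc1 : 1 <= ncrit by rewrite /ncrit lerBrDr -(natrD _ 1 1) ler_nat.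
have h_far r : R0 < r -> h r = 0.
  move=> Rr; apply/eqP; apply: contraT => hr.
  have /supp : closure [set r : R | 0 <= r /\ h r != 0] r.
    by apply: subset_closure; split=> //; lra.
  by rewrite /= in_itv/= => /andP[_]; lra.
(* [h] vanishes beyond [R0], so a maximum on [b, b + R0] is one on the half-line *)
have h_max (b : R) : 0 <= b -> exists2 r, b <= r & forall s, b <= s -> h s <= h r.
  move=> b0.
  have [||r rK rmax] := @usc_compact_max R R `[b, b + R0] h (@segment_compact _ _ _).
  - by exists b; rewrite /= in_itv/= lexx; lra.
  - move=> z; rewrite /= in_itv/= => /andP[bz _] a za.
    have z0 : 0 <= z by lra.
    have := h_usc _ z0 _ za; rewrite /within/=; apply: (@filterS _ _ (nbhs_filter z)) => y H.
    by rewrite in_itv/= => /andP[by0 _]; apply: H; lra.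
  exists r; first by move: rK; rewrite /= in_itv/= => /andP[].
  move=> s bs; have [sR|Rs] := leP s (b + R0).
    by apply: rmax; rewrite /= in_itv/= bs.
  rewrite h_far; last by lra.
  by apply: h_ge0; move: rK; rewrite /= in_itv/= => /andP[]; lra.
have [rM rM0 h_le] := h_max 0 (lexx _).
have n00 : 0 <= ncrit by lra.
have [r1 r1n r1max] := h_max ncrit n00.
have c1E : c1 = h r1.
  apply/eqP; rewrite eq_le; apply/andP; split.
    apply: ge_sup; first by exists (h r1), r1 => //; rewrite /= in_itv/= andbT.
    by move=> w [r /=]; rewrite in_itv/= andbT => nr <-; exact: r1max.
  apply: ub_le_sup; last by exists r1 => //; rewrite /= in_itv/= andbT.
  by exists (h r1) => w [r /=]; rewrite in_itv/= andbT => nr <-; exact: r1max.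
have c2sup : has_sup [set h r | r in `]ncrit, +oo[].
  split; first by exists (h (ncrit + 1)), (ncrit + 1) => //; rewrite /= in_itv/= andbT; lra.
  by exists (h rM) => w [r /=]; rewrite in_itv/= andbT => nr <-; apply: h_le; lra.
have h_c2 r : ncrit < r -> h r <= c2.
  move=> nr; apply: (sup_upper_bound c2sup); exists r => //.
  by rewrite /= in_itv/= andbT.
have c10 : 0 <= c1 by rewrite c1E h_ge0//; lra.
have c20 : 0 <= c2.
  by apply: le_trans (h_c2 (ncrit + 1) _); [apply: h_ge0|]; lra.
have [[u_sub _] u_supp u_ge] := u_max.
have u_value x t : 0 <= t -> value n h (dotv x x) t <= u (x, t).
  move=> t0; apply: (u_ge (radial_value h)) => //.
    exact: (value_viscosity n1 h_ge0 h_le h_usc).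
  exact: (value_compact_support n1 h_ge0 h_le R00 h_far).
split.
- by exists r1; rewrite ?c1E//= in_itv/= andbT.
- apply: uniform_growth => e e0.
  have h_c1 r : ncrit <= r -> h r <= c1 by rewrite c1E; exact: r1max.
  have [C uC] := growth_upper n1 h_ge0 h_le h_usc u_sub u_supp c10 e0 h_c1.
  pose C' := h r1 * (r1 ^+ 2 / (2 * ncrit)).
  exists (Num.max C C') => x t; rewrite /closed_eball/= subr0 => xn t0; split; last first.
    by apply: le_trans (uC x t t0) _; rewrite lerD2l le_max lexx.
  have xr : dotv x x <= r1 ^+ 2.
    rewrite -enorm_sqr ler_pXn2r ?nnegrE ?enorm_ge0//; last by lra.
    exact: le_trans r1n.
  have := value_lower_inside n1 h_ge0 h_le r1n (dotvv_ge0 x) xr t0.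
  have := u_value x t t0.
  have : 0 <= e * t by rewrite mulr_ge0// ltW.
  have : C' <= Num.max C C' by rewrite le_max lexx orbT.
  rewrite -/C' c1E; lra.
- move=> K cK KO.
  have [->|/set0P K0] := eqVneq K set0; first exact: cvg_uniform_set0.
  have [xm [xM [Kxm _ Kb]]] := dotv_compact_bounds cK K0.
  have xmn : ncrit < enorm xm.
    by have := KO _ Kxm; rewrite /closed_eball/= subr0 => /negP; rewrite -ltNge.
  pose kap := dotv xm xm - ncrit ^+ 2.
  have kap0 : 0 < kap.
    by rewrite subr_gt0 -enorm_sqr ltr_pXn2r ?nnegrE ?enorm_ge0.
  apply: uniform_growth => e e0.
  have [C uC] := growth_upper_outside n1 h_ge0 h_le h_usc u_sub u_supp c20 e0 kap0 h_c2.
  have [w [r2 /= r2n wE] r2c] := sup_adherent e0 c2sup.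
  rewrite in_itv/= andbT in r2n; rewrite -/c2 -wE in r2c.
  have r2n' : ncrit <= r2 by exact: ltW.
  pose C1 := h r2 * (r2 ^+ 2 / (2 * ncrit)).
  pose C2 := h r2 * (dotv xM xM / (2 * (r2 - ncrit))).
  exists (Num.max C (Num.max C1 C2)) => x t Kx t0; have [xmx xxM] := Kb x Kx; split; last first.
    apply: le_trans (uC x t t0 _) _; first by rewrite -/ncrit addrC subrK.
    by rewrite lerD2l le_max lexx.
  apply: le_trans (u_value x t t0).
  have et : (c2 - e) * t <= h r2 * t by rewrite ler_wpM2r// ltW.
  have [xr|rx] := leP (dotv x x) (r2 ^+ 2).
    have := value_lower_inside n1 h_ge0 h_le r2n' (dotvv_ge0 x) xr t0.
    have : C1 <= Num.max C (Num.max C1 C2) by rewrite !le_max lexx orbT.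
    by rewrite -/C1; lra.
  have := value_lower_outside n1 h_ge0 h_le r2n (ltW rx) t0.
  have : C2 <= Num.max C (Num.max C1 C2) by rewrite !le_max lexx !orbT.
  have : h r2 * (dotv x x / (2 * (r2 - ncrit))) <= C2.
    rewrite ler_wpM2l ?h_ge0//; first by lra.
    by rewrite ler_pM2r// invr_gt0 mulr_gt0// subr_gt0.
  lra.
Qed.
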